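(* Let $A\subset\mathbb{R}^N$ be nonempty and closed and assume $H:[0,\infty)\times\mathbb{R}^N\times\mathbb{R}^N\to\mathbb{R}$ satisfies $(h)''_H$ relative to $A$, with functions $\phi,\lambda,c,k,q$. Then there exist $f:[0,\infty)\times\mathbb{R}^N\times\mathbb{R}^{N+1}\to\mathbb{R}^N$ and $l:[0,\infty)\times\mathbb{R}^N\times\mathbb{R}^{N+1}\to\mathbb{R}$, measurable in $t$ for all $(x,u)$ and continuous in $(x,u)$ for all $t$, such that for every $t\in[0,\infty)$, $x,p\in\mathbb{R}^N$, $$H(t,x,p)=\sup_{u\in\mathbb{B}}\{\langle p,f(t,x,u)\rangle-l(t,x,u)\}$$ and $f(t,x,\mathbb{B})=\mathrm{dom}\,H^*(t,x,\cdot)$, where $\mathbb{B}$ is the closed unit ball in $\mathbb{R}^{N+1}$. Additionally: (A1) $|f(t,x,u)-f(t,y,u)|+|l(t,x,u)-l(t,y,u)|\le 40(N+1)k(t)|x-y|$ for all $t\ge0$, $x,y\in\mathbb{R}^N$, $u\in\mathbb{B}$; (A2) $|f(t,x,u)|+|l(t,x,u)|\le 20\lambda(t,x)$ for all $t\ge0$, $x\in\mathbb{R}^N$, $u\in\mathbb{B}$; (A3) $\mathrm{gph}\,H^*(t,x,\cdot)\subset (f,l)(t,x,\mathbb{B})\subset\mathrm{epi}\,H^*(t,x,\cdot)$ for all $t\ge0$, $x\in\mathbb{R}^N$; (A4) $l(t,x,u)\ge\phi(t)$ for all $t\ge0$, $x\in\mathbb{R}^N$, $u\in\mathbb{R}^{N+1}$;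 (A5) if moreover $H$ and $\lambda$ are continuous, then so are $f$ and $l$.
   Context: For $H$ convex in the last variable, $H^*(t,x,v)=\sup_{p}\{\langle v,p\rangle-H(t,x,p)\}\in\mathbb{R}\cup\{+\infty\}$, $\mathrm{dom}\,H^*(t,x,\cdot)=\{v:H^*(t,x,v)<+\infty\}$; $\mathrm{gph}$, $\mathrm{epi}$ denote graph (over the domain) and epigraph; $(f,l)(t,x,u)=(f(t,x,u),l(t,x,u))$. $\mathrm{bd}A$ is the boundary of $A$. $\mathscr{L}_{\rm loc}$ is the set of $\varphi\in L^1_{\rm loc}([0,\infty);[0,\infty))$ with $\lim_{\sigma\to0}\theta_\varphi(\sigma)=0$, where $\theta_\varphi(\sigma)=\sup\{\int_I\varphi : I$ compact subinterval of $[0,\infty)$ of length $\le\sigma\}$. Condition $(h)''_H$ relative to $A$: (H1) $H$ is measurable in $t$, continuous in $x$, convex in $p$; (H2) $H(t,x,0)\le-\phi(t)$ for all $t,x$, with $\phi\in L^1([0,\infty);\mathbb{R})$; and there exist $\lambda:[0,\infty)\times\mathbb{R}^N\to[0,\infty)$ measurable in $t$ and continuous in $x$, $c\in L^1_{\rm loc}([0,\infty);[0,\infty))$, $k,q\in\mathscr{L}_{\rm loc}$ with, for all $t\ge0$ and $x,y,p,q\in\mathbb{R}^N$: (H3) $\lambda(t,x)\le c(t)(1+|x|)$, and $\lambda(t,x)\le q(t)$ if $x\in\mathrm{bd}A$; (H4) $|\lambda(t,x)-\lambda(t,y)|\le k(t)|x-y|$; (H5) $|H(t,x,p)-H(t,y,p)|\le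 k(t)(1+|p|)|x-y|$; (H6) $|H(t,x,p)-H(t,x,q)|\le\lambda(t,x)|p-q|$; (H7) $|H^*(t,x,v)|\le\lambda(t,x)$ for all $v\in\mathrm{dom}\,H^*(t,x,\cdot)$. *)

(* Defs.v *)
From HB Require Import structures.
From mathcomp Require Import all_boot all_order all_algebra.
From mathcomp Require Import all_classical all_reals all_analysis.
Set Implicit Arguments. Unset Strict Implicit. Unset Printing Implicit Defensive.
Import Order.TTheory GRing.Theory Num.Theory.
Import numFieldNormedType.Exports.
Local Open Scope classical_set_scope.
Local Open Scope ring_scope.

Section Defs.
Variable R : realType.

(** The real line equipped with the (completed) Lebesgue sigma-algebra. *)
Definition LebR : Type :=
  caratheodory_type (R:=R) (wlength (R:=R) idfun)^*%mu.

Definition lmu : set LebR -> \bar R := @completed_lebesgue_measure R.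

Definition lmeasurable (D : set R) (g : R -> R) : Prop :=
  @measurable_fun _ _ LebR R (D : set LebR) (g : LebR -> R).

Definition lint (D : set R) (g : R -> R) : \bar R :=
  (\int[lmu]_(t in (D : set LebR)) (g t)%:E)%E.

Definition lintegrable (D : set R) (g : R -> R) : Prop :=
  lmu.-integrable (D : set LebR) (fun t : LebR => (g t)%:E).

Definition L1_pos (g : R -> R) : Prop := lintegrable `[0, +oo[ g.

Definition L1loc_nonneg (g : R -> R) : Prop :=
  (forall t, 0 <= t -> 0 <= g t) /\
  (forall a b, 0 <= a -> a <= b -> lintegrable `[a, b] g).

Definition theta (g : R -> R) (sigma : R) : \bar R :=
  ereal_sup [set lint `[ab.1, ab.2] g | ab in
     [set ab : R * R | 0 <= ab.1 /\ ab.1 <= ab.2 /\ ab.2 - ab.1 <= sigma]].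

Definition dotv (n : nat) (p v : 'rV[R]_n) : R := \sum_(i < n) p 0 i * v 0 i.
Definition enorm (n : nat) (v : 'rV[R]_n) : R := Num.sqrt (dotv v v).

Definition cball1 (n : nat) : set 'rV[R]_n := [set u | enorm u <= 1].

Definition bd (n : nat) (A : set 'rV[R]_n) : set 'rV[R]_n :=
  closure A `\` A°.

Definition Hstar (N : nat) (H : R -> 'rV[R]_N -> 'rV[R]_N -> R)
  (t : R) (x v : 'rV[R]_N) : \bar R :=
  ereal_sup [set (dotv v p - H t x p)%:E | p in [set: 'rV[R]_N]].

Definition domHs (N : nat) (H : R -> 'rV[R]_N -> 'rV[R]_N -> R)
  (t : R) (x : 'rV[R]_N) : set 'rV[R]_N :=
  [set v | (Hstar H t x v < +oo)%E].

Definition gphHs (N : nat) (H : R -> 'rV[R]_N -> 'rV[R]_N -> R)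
  (t : R) (x : 'rV[R]_N) : set ('rV[R]_N * R) :=
  [set vr | domHs H t x vr.1 /\ Hstar H t x vr.1 = vr.2%:E].

Definition epiHs (N : nat) (H : R -> 'rV[R]_N -> 'rV[R]_N -> R)
  (t : R) (x : 'rV[R]_N) : set ('rV[R]_N * R) :=
  [set vr | (Hstar H t x vr.1 <= vr.2%:E)%E].

Definition theta_vanishes (g : R -> R) : Prop :=
  theta g sigma @[sigma --> 0^'+] --> 0%E.

Definition Lloc (g : R -> R) : Prop := L1loc_nonneg g /\ theta_vanishes g.

Definition cond_hH (N : nat) (A : set 'rV[R]_N)
  (H : R -> 'rV[R]_N -> 'rV[R]_N -> R) (phi : R -> R)
  (lam : R -> 'rV[R]_N -> R) (c k q : R -> R) : Prop :=
  (forall x p, lmeasurable `[0, +oo[ (fun t => H t x p)) /\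
  (forall t p, 0 <= t -> continuous (fun x => H t x p)) /\
  (forall t x, 0 <= t ->
     convex_function (E := 'rV[R]_N) [set: 'rV[R]_N] (fun p => H t x p)) /\
  (forall t x, 0 <= t -> H t x 0 <= - phi t) /\
  L1_pos phi /\
  (forall t x, 0 <= t -> 0 <= lam t x) /\
  (forall x, lmeasurable `[0, +oo[ (fun t => lam t x)) /\
  (forall t, 0 <= t -> continuous (fun x => lam t x)) /\
  L1loc_nonneg c /\ Lloc k /\ Lloc q /\
  (forall t x, 0 <= t -> lam t x <= c t * (1 + enorm x)) /\
  (forall t x, 0 <= t -> bd A x -> lam t x <= q t) /\
  (forall t x y, 0 <= t -> `|lam t x - lam t y| <= k t * enorm (x - y)) /\
  (forall t x y p, 0 <= t ->
     `|H t x p - H t y p| <= k t * (1 + enorm p) * enorm (x - y)) /\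
  (forall t x p p', 0 <= t ->
     `|H t x p - H t x p'| <= lam t x * enorm (p - p')) /\
  (forall t x v, 0 <= t -> domHs H t x v ->
     ((- lam t x)%:E <= Hstar H t x v <= (lam t x)%:E)%E).
End Defs.

(* Main.v *)
Require Import Defs.
From HB Require Import structures.
From mathcomp Require Import all_boot all_order all_algebra.
From mathcomp Require Import all_classical all_reals all_analysis.
From mathcomp Require Import measurable_realfun ring lra zify.
Set Implicit Arguments. Unset Strict Implicit. Unset Printing Implicit Defensive.
Import Order.TTheory GRing.Theory Num.Theory.
Import numFieldNormedType.Exports.
Local Open Scope classical_set_scope.
Local Open Scope ring_scope.

(**
For fixed [(t, x)] let [E] be the epigraph of [H^*(t, x, .)] in [R^(N+1)], written
with the vertical coordinate first, and let [h_u(P) = sup_(w in E) <P, w> - 2 |w - u|_1]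
for [|P|_oo <= 2]. The gradient of [h_u] lies in [E] wherever it exists, and if [u]
belongs to [E] then [h_u(P) = <P, u>]. Hence the mean of that gradient over the unit
cube, a variant of the Steiner point, is a point of [E] equal to [u] when [u] is in [E].
By the divergence theorem this mean only involves differences of values of [h_u] on
opposite faces, so it is Lipschitz with respect to [h_u] for the sup norm, and it is the
limit of finite sums.

A Hahn-Banach sandwich argument shows that the distance from [w = (r, v)] to [E] is at
most a multiple of [rho(w) = sup_y (<v, y> - r - H(y))^+ / (1 + |y|)]. Thus [h_u] is also
[sup_w <P, w> - 2 |w - u|_1 - C rho(w)] over all [w], where [H] enters through [rho]
only: the Lipschitz bound in [x], the measurability in [t] and the continuity are read
off this formula. The pair [(l, f)] is the mean gradient for the point [2 lambda(t, x) u],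
with its vertical coordinate truncated at [lambda(t, x)].
*)

(** * Inner product, Euclidean norm, sup norm ([|v|]) and l1 norm of row vectors *)

Section Euclidean.
Variables (R : realType) (n : nat).
Implicit Types (u v w : 'rV[R]_n).

Definition norm1 v : R := \sum_(i < n) `|v 0 i|.

Lemma dotvC u v : dotv u v = dotv v u.
Proof. by apply: eq_bigr => i _; rewrite mulrC. Qed.

Lemma dotvDr u v w : dotv u (v + w) = dotv u v + dotv u w.
Proof. by rewrite -big_split /=; apply: eq_bigr => i _; rewrite mxE mulrDr. Qed.

Lemma dotvZr a u v : dotv u (a *: v) = a * dotv u v.
Proof. by rewrite mulr_sumr; apply: eq_bigr => i _; rewrite mxE mulrCA. Qed.

Lemma dotvNr u v : dotv u (- v) = - dotv u v.
Proof. by rewrite -scaleN1r dotvZr mulN1r. Qed.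

Lemma dotvBr u v w : dotv u (v - w) = dotv u v - dotv u w.
Proof. by rewrite dotvDr dotvNr. Qed.

Lemma dotv0r u : dotv u 0 = 0.
Proof. by rewrite -(scale0r 0) dotvZr mul0r. Qed.

Lemma dotvDl u v w : dotv (u + v) w = dotv u w + dotv v w.
Proof. by rewrite dotvC dotvDr ![dotv w _]dotvC. Qed.

Lemma dotvZl a u v : dotv (a *: u) v = a * dotv u v.
Proof. by rewrite dotvC dotvZr dotvC. Qed.

Lemma dotvNl u v : dotv (- u) v = - dotv u v.
Proof. by rewrite dotvC dotvNr dotvC. Qed.

Lemma dotvBl u v w : dotv (u - v) w = dotv u w - dotv v w.
Proof. by rewrite dotvDl dotvNl. Qed.

Lemma dotv0l u : dotv 0 u = 0.
Proof. by rewrite dotvC dotv0r. Qed.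

Lemma dotvv_ge0 v : 0 <= dotv v v.
Proof. by apply: sumr_ge0 => i _; rewrite -expr2 sqr_ge0. Qed.

Lemma enorm_ge0 v : 0 <= enorm v.
Proof. exact: sqrtr_ge0. Qed.

Lemma sqr_enorm v : enorm v ^+ 2 = dotv v v.
Proof. by rewrite sqr_sqrtr ?dotvv_ge0. Qed.

Lemma enorm0 : enorm (0 : 'rV[R]_n) = 0.
Proof. by rewrite /enorm dotv0r sqrtr0. Qed.

Lemma enormZ a v : enorm (a *: v) = `|a| * enorm v.
Proof.
by rewrite /enorm dotvZr dotvZl mulrA -expr2 sqrtrM ?sqr_ge0// sqrtr_sqr.
Qed.

Lemma enormN v : enorm (- v) = enorm v.
Proof. by rewrite -scaleN1r enormZ normrN1 mul1r. Qed.

Lemma enorm_distC u v : enorm (u - v) = enorm (v - u).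
Proof. by rewrite -enormN opprB. Qed.

(** Nonnegativity of the squared norm of [s *: u - t *: v]: the weights [s = b], [t = a] settle the
    case [a * b != 0]. *)
Lemma cauchy_schwarz u v : dotv u v <= enorm u * enorm v.
Proof.
set a := enorm u; set b := enorm v.
have a0 : 0 <= a := enorm_ge0 u.
have b0 : 0 <= b := enorm_ge0 v.
have aE : a ^+ 2 = dotv u u := sqr_enorm u.
have bE : b ^+ 2 = dotv v v := sqr_enorm v.
have key s t : 2 * (s * t * dotv u v) <= s ^+ 2 * a ^+ 2 + t ^+ 2 * b ^+ 2.
  have := dotvv_ge0 (s *: u - t *: v).
  rewrite !(dotvBl, dotvBr, dotvZl, dotvZr) (dotvC v u) aE bE; lra.
have [ab0|abN] := eqVneq (a * b) 0; last first.
  have ab_gt0 : 0 < a * b by rewrite lt_def abN mulr_ge0.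
  rewrite -(@ler_pM2l _ (a * b))//; have := key b a; lra.
rewrite ab0 leNgt; apply/negP => uv0.
have [a0'|b0'] : a = 0 \/ b = 0.
- by move/eqP: ab0; rewrite mulf_eq0 => /orP[] /eqP; [left|right].
(* When one norm vanishes, a large weight on that vector contradicts [0 < dotv u v]. *)
- have := key ((b ^+ 2 + 1) / dotv u v) 1; rewrite a0' mulr1 divfK ?gt_eqF//.
  nra.
- have := key 1 ((a ^+ 2 + 1) / dotv u v); rewrite b0' mul1r divfK ?gt_eqF//.
  nra.
Qed.

Lemma enormD u v : enorm (u + v) <= enorm u + enorm v.
Proof.
rewrite -(@ler_pXn2r _ 2)// ?nnegrE ?addr_ge0 ?enorm_ge0//.
rewrite sqr_enorm dotvDl !dotvDr (dotvC v u) -!sqr_enorm.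
have := cauchy_schwarz u v; lra.
Qed.

Lemma normr_entry v i : `|v 0 i| <= `|v|.
Proof.
rewrite [leRHS]/Num.norm /= mx_normrE; apply/bigmax_geP; right => /=.
by exists (0, i).
Qed.

Lemma mxnorm_le v a : 0 <= a -> (forall i, `|v 0 i| <= a) -> `|v| <= a.
Proof.
move=> a0 va; rewrite [leLHS]/Num.norm /= mx_normrE; apply/bigmax_leP; split=> //.
by move=> [i j] _ /=; rewrite ord1.
Qed.

Lemma enorm_entry v i : `|v 0 i| <= enorm v.
Proof.
rewrite -sqrtr_sqr ler_sqrt ?dotvv_ge0// /dotv (bigD1 i)//= -expr2 lerDl.
by apply: sumr_ge0 => j _; rewrite -expr2 sqr_ge0.
Qed.

Lemma mxnorm_le_enorm v : `|v| <= enorm v.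
Proof. by apply: mxnorm_le; [exact: enorm_ge0 | exact: enorm_entry]. Qed.

Lemma enorm_le v a : 0 <= a -> (forall i, `|v 0 i| <= a) ->
  enorm v <= Num.sqrt n%:R * a.
Proof.
move=> a0 va.
rewrite -[X in _ * X](@ger0_norm _ a)// -sqrtr_sqr -sqrtrM ?ler0n//.
rewrite ler_sqrt ?mulr_ge0 ?sqr_ge0//.
rewrite mulr_natl -[X in _ *+ X](card_ord n) -sumr_const.
apply: ler_sum => i _; rewrite -expr2 -real_normK ?num_real//.
by rewrite ler_pXn2r ?nnegrE ?normr_ge0.
Qed.

Lemma enorm_le_mxnorm v : enorm v <= Num.sqrt n%:R * `|v|.
Proof. by apply: enorm_le => // i; exact: normr_entry. Qed.

Lemma norm1_ge0 v : 0 <= norm1 v.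
Proof. by apply: sumr_ge0 => i _; exact: normr_ge0. Qed.

Lemma norm1D u v : norm1 (u + v) <= norm1 u + norm1 v.
Proof. by rewrite -big_split /=; apply: ler_sum => i _; rewrite mxE ler_normD. Qed.

Lemma norm1N v : norm1 (- v) = norm1 v.
Proof. by apply: eq_bigr => i _; rewrite mxE normrN. Qed.

Lemma norm1Z a v : norm1 (a *: v) = `|a| * norm1 v.
Proof. by rewrite mulr_sumr; apply: eq_bigr => i _; rewrite mxE normrM. Qed.

Lemma norm1_distC u v : norm1 (u - v) = norm1 (v - u).
Proof. by rewrite -norm1N opprB. Qed.

(** Cauchy-Schwarz against the vector of signs of [v]. *)
Lemma norm1_le_enorm v : norm1 v <= Num.sqrt n%:R * enorm v.
Proof.
pose s := \row_i Num.sg (v 0 i).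
have -> : norm1 v = dotv s v by apply: eq_bigr => i _; rewrite mxE normrEsg.
apply: le_trans (cauchy_schwarz _ _) _; apply: (ler_wpM2r (enorm_ge0 v)).
rewrite -[X in _ <= X]mulr1; apply: enorm_le => // i.
by rewrite mxE normr_sg lern1 leq_b1.
Qed.

Lemma norm1_le_mxnorm v : norm1 v <= n%:R * `|v|.
Proof.
rewrite mulr_natl -[X in _ *+ X](card_ord n) -sumr_const.
by apply: ler_sum => i _; exact: normr_entry.
Qed.

Lemma dotv_le_norm1 u v : `|dotv u v| <= `|u| * norm1 v.
Proof.
rewrite mulr_sumr; apply: le_trans (ler_norm_sum _ _ _) _.
by apply: ler_sum => i _; rewrite normrM; apply: ler_wpM2r => //; exact: normr_entry.
Qed.

End Euclidean.

(** * Suprema and infima of real functions on an inhabited type *)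

Section SupRange.
Variables (R : realType) (T : Type) (x0 : T).
Implicit Types F G : T -> R.

Definition bounded_above F := exists b, forall x, F x <= b.

Lemma sup_range_le F b : (forall x, F x <= b) -> sup (range F) <= b.
Proof. by move=> Fb; apply: ge_sup => [|_ [x _ <-]//]; exists (F x0), x0. Qed.

Lemma sup_range_ge F x : bounded_above F -> F x <= sup (range F).
Proof.
by move=> [b Fb]; apply: ub_le_sup; [exists b => _ [y _ <-]|exists x].
Qed.

Lemma le_sup_range F G e : bounded_above G ->
  (forall x, exists y, F x <= G y + e) -> sup (range F) <= sup (range G) + e.
Proof.
move=> bG FG; apply: sup_range_le => x; have [y Fxy] := FG x.
by apply: le_trans Fxy _; rewrite lerD2r sup_range_ge.
Qed.

Lemma inf_range_ge F b : (forall x, b <= F x) -> b <= inf (range F).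
Proof. by move=> Fb; apply: lb_le_inf => [|_ [x _ <-]//]; exists (F x0), x0. Qed.

Lemma inf_range_le F x : (exists b, forall x, b <= F x) -> inf (range F) <= F x.
Proof.
by move=> [b Fb]; apply: ge_inf; [exists b => _ [y _ <-]|exists x].
Qed.

End SupRange.

(** * Convex functions: partial minimisation, subgradients, separation *)

Section Convexity.
Variable R : realType.

Definition convexf (E : lmodType R) (F : E -> R) := forall (a : R) x y,
  0 <= a -> a <= 1 -> F (a *: x + (1 - a) *: y) <= a * F x + (1 - a) * F y.

(** Partial minimisation keeps joint convexity: the convex combination of near-minimisers for [x]
    and [y] is a competitor for the combined point. *)
Lemma convexf_inf (E E' : lmodType R) (F : E -> E' -> R) :
  (forall x, exists b, forall z, b <= F x z) ->
  (forall (a : R) x y z z', 0 <= a -> a <= 1 ->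
    F (a *: x + (1 - a) *: y) (a *: z + (1 - a) *: z')
      <= a * F x z + (1 - a) * F y z') ->
  convexf (fun x => inf (range (F x))).
Proof.
move=> lb cF a x y a0 a1; apply/ler_addgt0Pr => e e0.
have near x' : exists z, F x' z < inf (range (F x')) + e.
  have [//||_ [z _ <-] lez] := @inf_adherent _ (range (F x')) e; last by exists z.
  split; first by exists (F x' 0), 0.
  by have [b Fb] := lb x'; exists b => _ [z _ <-].
have [z Fz] := near x; have [z' Fz'] := near y.
apply: (@le_trans _ _ (F (a *: x + (1 - a) *: y) (a *: z + (1 - a) *: z'))).
  exact: inf_range_le.
apply: le_trans (cF _ _ _ _ _ a0 a1) _; nra.
Qed.

Lemma convex_functionP N (F : 'rV[R]_N -> R) :
  convex_function (E := 'rV[R]_N) [set: 'rV[R]_N] F -> convexf F.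
Proof.
move=> cF a x y a0 a1.
have a01 : Itv.spec (@Itv.num_sem R) (Itv.Real `[0%Z, 1%Z]) a.
  by rewrite /= /Itv.num_sem num_real /= in_itv /= a0 a1.
have := cF (Itv.mk a01) x y (in_setT _) (in_setT _).
by [].
Qed.

(* One coordinate at a time: [c] is a supporting slope on the line [R e_0], and
   subtracting it allows minimising over that line. *)
Lemma linear_minorant n (G : 'rV[R]_n -> R) : convexf G -> 0 <= G 0 ->
  exists v, forall y, dotv v y <= G y.
Proof.
elim: n G => [|n IH] G cG G0.
  by exists 0 => y; rewrite dotv0l (_ : y = 0)//; apply/rowP => -[].
pose mk (s : R) (y : 'rV[R]_n) : 'rV[R]_n.+1 :=
  \row_j (if unlift ord0 j is Some i then y 0 i else s).
have mk0 s y : mk s y 0 ord0 = s by rewrite mxE unlift_none.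
have mkS s y i : mk s y 0 (lift ord0 i) = y 0 i by rewrite mxE liftK.
have mkE (z : 'rV[R]_n.+1) : z = mk (z 0 ord0) (\row_i z 0 (lift ord0 i)).
  apply/rowP => j; case: (unliftP ord0 j) => [i ->|->].
    by rewrite mkS mxE.
  by rewrite mk0.
have mkZD a s y s' y' :
    mk (a * s + (1 - a) * s') (a *: y + (1 - a) *: y')
    = a *: mk s y + (1 - a) *: mk s' y'.
  by apply/rowP => j; rewrite !mxE; case: unlift => [i|] //; rewrite !mxE.
have [c cP] : exists c, forall s, c * s <= G (mk s 0).
  pose A := range (fun s : {posnum R} => - G (mk (- s%:num) 0) / s%:num).
  (* Slopes on the left lie below slopes on the right, because [0] is a convex combination of [- s]
     and [s'] on the line and [0 <= G 0]. The slope [c] is the supremum of the left ones. *)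
  have AB (s s' : R) : 0 < s -> 0 < s' ->
      - G (mk (- s) 0) / s <= G (mk s' 0) / s'.
    move=> s0 s0'; rewrite ler_pdivrMr// mulrAC ler_pdivlMr//.
    have ss0 : 0 < s + s' by lra.
    have := cG (s' / (s + s')) (mk (- s) 0) (mk s' 0).
    have -> : 1 - s' / (s + s') = s / (s + s') by field; lra.
    rewrite divr_ge0 ?ler_pdivrMr ?mul1r; [|lra..].
    move=> /(_ isT)/(_ _)/le_trans.
    have -> : s' / (s + s') *: mk (- s) 0 + s / (s + s') *: mk s' 0 = 0.
      apply/rowP => j; rewrite !mxE.
      case: unlift => [i|]; rewrite ?mxE ?mulr0 ?addr0//.
      by field; lra.
    move=> cG'; have : 0 <= s' / (s + s') * G (mk (- s) 0) + s / (s + s') * G (mk s' 0).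
      by apply: le_trans G0 _; apply: cG'; lra.
    rewrite ![_ / (s + s') * _]mulrAC -mulrDl pmulr_lge0 ?invr_gt0//; lra.
  have supA : has_sup A.
    split; first by exists (- G (mk (- 1) 0) / 1), (1%:pos).
    by exists (G (mk 1 0) / 1) => _ [s _ <-]; apply: AB.
  exists (sup A) => s; have [s0|s0|->] := ltgtP s 0.
  - have : - G (mk (- (- s)) 0) / (- s) <= sup A.
      apply: ub_le_sup; first by case: supA.
      by have s0' : 0 < - s by [lra]; exists (PosNum s0').
    by rewrite opprK ler_pdivrMr; lra.
  - have : sup A <= G (mk s 0) / s.
      by apply: ge_sup; [case: supA|move=> _ [s' _ <-]; exact: AB].
    by rewrite ler_pdivlMr.
  - rewrite mulr0 (_ : mk 0 0 = 0)//; apply/rowP => j; rewrite !mxE.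
    by case: unlift => // i; rewrite mxE.
pose F y (s : R^o) := G (mk s y) - c * s.
have lbF y : exists b, forall s, b <= F y s.
  (* The midpoint of [mk s y] and [mk 0 (- y)] lies on the line [R e_0], where [c] already bounds
     [G] from below. *)
  exists (- G (mk 0 (- y))) => s; rewrite /F.
  have := cG 2^-1 (mk s y) (mk 0 (- y)).
  rewrite (_ : 1 - 2^-1 = 2^-1); last by field.
  have := cP (2^-1 * s).
  have -> : mk (2^-1 * s) 0 = 2^-1 *: mk s y + 2^-1 *: mk 0 (- y).
    have := mkZD 2^-1 s y 0 (- y); rewrite (_ : 1 - 2^-1 = 2^-1 :> R); last by field.
    by rewrite mulr0 addr0 scalerN subrr => ->.
  move=> cPs /(_ _ _)/(le_trans cPs); rewrite invr_ge0 ler0n invf_le1// ler1n => /(_ isT isT).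
  lra.
have cF : convexf (fun y => inf (range (F y))).
  apply: convexf_inf => // a x y z0 z0' a0 a1.
  suff cF z z' : G (mk (a * z + (1 - a) * z') (a *: x + (1 - a) *: y))
      - c * (a * z + (1 - a) * z')
      <= a * (G (mk z x) - c * z) + (1 - a) * (G (mk z' y) - c * z').
    exact: cF.
  by rewrite mkZD; have := cG a (mk z x) (mk z' y) a0 a1; lra.
have [|v vP] := IH _ cF.
  by apply: (@inf_range_ge _ _ 0) => s; rewrite /F subr_ge0.
exists (mk c v) => y; rewrite [in X in _ <= X](mkE y) /dotv big_ord_recl mk0.
under eq_bigr do rewrite mkS.
have yE : dotv v (\row_i y 0 (lift ord0 i)) = \sum_i v 0 i * y 0 (lift ord0 i).
  by apply: eq_bigr => i _; rewrite mxE.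
have := vP (\row_i y 0 (lift ord0 i)); rewrite yE.
have := @inf_range_le _ _ (F (\row_i y 0 (lift ord0 i))) (y 0 ord0) (lbF _).
by rewrite /F; lra.
Qed.

(** [G] is recentred at [p], so that it vanishes at the origin and has a linear minorant. *)
Lemma subgradient n (G : 'rV[R]_n -> R) p : convexf G ->
  exists v, forall y : 'rV[R]_n, G p + dotv v (y - p) <= G y.
Proof.
move=> cG; have [||v vP] := @linear_minorant n (fun y => G (p + y) - G p).
- move=> a x y a0 a1 /=; have := cG a (p + x) (p + y) a0 a1.
  rewrite !scalerDr [X in G X <= _]addrACA -scalerDl subrKC scale1r.
  suff aux (A B C D : R) : A <= a * B + (1 - a) * C ->
      A - D <= a * (B - D) + (1 - a) * (C - D) by exact: aux.
  by lra.
- by rewrite addr0 subrr.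
exists v => y; rewrite addrC -lerBrDr; apply: le_trans (vP _) _.
by rewrite subrKC.
Qed.

(** The inequality is tested on a large multiple of [v] itself. *)
Lemma linear_growth n (v : 'rV[R]_n) a b : 0 <= a ->
  (forall y, dotv v y <= b + a * enorm y) -> enorm v <= a.
Proof.
move=> a0 vab; rewrite leNgt; apply/negP => av.
have d0 : 0 < enorm v - a by lra.
have v0 : 0 < enorm v by lra.
(* Solves [s * (enorm v * (enorm v - a)) = |b| + 1], which exceeds [b]. *)
pose s := (`|b| + 1) / (enorm v * (enorm v - a)).
have s0 : 0 <= s by rewrite divr_ge0 ?mulr_ge0 ?(ltW d0) ?(ltW v0) ?addr_ge0.
have := vab (s *: v); rewrite dotvZr -sqr_enorm enormZ (ger0_norm s0).
have : s * (enorm v * (enorm v - a)) = `|b| + 1.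
  by rewrite divfK// mulf_neq0// gt_eqF.
have := ler_norm b; rewrite expr2; lra.
Qed.

(* A Hahn-Banach sandwich: an affine function separating the convex function
   [H + r + e] from the concave function [<v, .> - e |.|]. *)
Lemma sandwich n (H : 'rV[R]_n -> R) v r e : convexf H -> 0 <= e ->
  (forall y, dotv v y - r - e * (1 + enorm y) <= H y) ->
  exists v', enorm (v' - v) <= e /\ forall y, dotv v' y - (r + e) <= H y.
Proof.
move=> cH e0 vH.
(* The perturbation [p] shifts the concave function, and the infimum over [q] is convex in [p] and
   nonnegative at [0] by hypothesis. A linear minorant [v'] of it is the separating slope: [q = p]
   gives the bound by [H], and [q = 0] gives [enorm (v' - v) <= e]. *)
pose F (p q : 'rV[R]_n) := H q + r + e + e * enorm (q - p) - dotv v (q - p).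
have lbF p : exists b, forall q, b <= F p q.
  exists (dotv v p - e * enorm p) => q; rewrite /F dotvBr.
  have := vH q; have : enorm q <= enorm (q - p) + enorm p.
    by apply: le_trans (enormD _ _); rewrite subrK.
  nra.
have cF : convexf (fun p => inf (range (F p))).
  apply: convexf_inf => // a + + + + a0 a1.
  suff cF (x y z z' : 'rV[R]_n) : F (a *: x + (1 - a) *: y) (a *: z + (1 - a) *: z')
      <= a * F x z + (1 - a) * F y z' by exact: cF.
  have zE : a *: z + (1 - a) *: z' - (a *: x + (1 - a) *: y)
          = a *: (z - x) + (1 - a) *: (z' - y).
    by rewrite !scalerBr opprD addrACA.
  have := enormD (a *: (z - x)) ((1 - a) *: (z' - y)).
  have dE : dotv v (a *: (z - x) + (1 - a) *: (z' - y))
      = a * dotv v (z - x) + (1 - a) * dotv v (z' - y).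
    by rewrite (dotvDr v (a *: (z - x))) !dotvZr.
  rewrite /F zE dE !enormZ !ger0_norm ?subr_ge0// => le_e.
  have := ler_wpM2l e0 le_e; have := cH a z z' a0 a1; lra.
have [|v' v'P] := linear_minorant cF.
  apply: (@inf_range_ge _ _ 0) => q; rewrite /F subr0; have := vH q; lra.
exists v'; split; last first.
  move=> y; have := v'P y; have := @inf_range_le _ _ (F y) y (lbF y).
  by rewrite /F subrr enorm0 dotv0r; lra.
apply: (linear_growth (b := H 0 + r + e)) => // y.
have := v'P y; have := @inf_range_le _ _ (F y) 0 (lbF y).
by rewrite /F sub0r enormN dotvNr dotvBl; lra.
Qed.

End Convexity.

(** * Riemann sums over the unit cube and the mean gradient *)

Section CubeMean.
Variables (R : realType) (n : nat).
Implicit Types (h g : 'rV[R]_n -> R) (P Q : 'rV[R]_n) (M m : nat) (i : 'I_n).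

(** Lower corners of the [M ^ n] cells of side [1 / M]; [gridmean] is the corresponding Riemann
    sum. *)
Definition gridpt M (a : {ffun 'I_n -> 'I_M}) : 'rV[R]_n :=
  \row_i ((a i)%:R / M%:R).

Definition gridmean M h : R := (\sum_a h (@gridpt M a)) / (M ^ n)%:R.

Definition setcoord i (s : R) P : 'rV[R]_n :=
  \row_j (if j == i then s else P 0 j).

Definition jump i h P : R := h (setcoord i 1 P) - h (setcoord i 0 P).

(* By the divergence theorem this is the mean over the unit cube of the (almost
   everywhere defined) gradient of a Lipschitz function [h]. *)
Definition cubegrad h : 'rV[R]_n :=
  \row_i limn (fun m => gridmean (2 ^ m) (jump i h)).

Definition lipschitz (L : R) h :=
  0 <= L /\ forall P Q, `|h P - h Q| <= L * `|P - Q|.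

Lemma gridpt_ge0 M (a : {ffun 'I_n -> 'I_M}) i : 0 <= gridpt a 0 i.
Proof. by rewrite mxE divr_ge0. Qed.

Lemma gridpt_le1 M (a : {ffun 'I_n -> 'I_M}) i : gridpt a 0 i <= 1.
Proof.
rewrite mxE; case: M a => [|M] a; first by case: (a i).
by rewrite ler_pdivrMr ?ltr0n// mul1r ler_nat ltnW.
Qed.

Lemma gridmean_cst M c : (0 < M)%N -> gridmean M (fun=> c) = c.
Proof.
move=> M0; rewrite /gridmean sumr_const card_ffun !card_ord -[c *+ _]mulr_natr.
by rewrite mulfK// pnatr_eq0 expn_eq0 negb_and -lt0n M0.
Qed.

Lemma gridmeanB M h g : gridmean M h - gridmean M g = gridmean M (fun P => h P - g P).
Proof. by rewrite /gridmean -mulrBl sumrB. Qed.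

Lemma ler_gridmean M h g : (forall a, h (@gridpt M a) <= g (gridpt a)) ->
  gridmean M h <= gridmean M g.
Proof. by move=> hg; rewrite ler_wpM2r ?invr_ge0//; apply: ler_sum. Qed.

Lemma norm_gridmean M h e : (0 < M)%N -> (forall a, `|h (@gridpt M a)| <= e) ->
  `|gridmean M h| <= e.
Proof.
move=> M0 he; rewrite -[leRHS](gridmean_cst _ M0) ler_norml.
rewrite (_ : - _ = gridmean M (fun=> - e)); last by rewrite !gridmean_cst.
by apply/andP; split; apply: ler_gridmean => a; have := he a; rewrite ler_norml => /andP[].
Qed.

Lemma lipschitz_jump L h i : lipschitz L h -> lipschitz (2 * L) (jump i h).
Proof.
move=> [L0 Lh]; split=> [|P Q]; first by lra.
have setL s : `|h (setcoord i s P) - h (setcoord i s Q)| <= L * `|P - Q|.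
  apply: le_trans (Lh _ _) _; apply: ler_wpM2l => //; apply: mxnorm_le => // j.
  rewrite !mxE; case: ifP => _; rewrite ?subrr ?normr0//.
  by have := normr_entry (P - Q) j; rewrite !mxE.
have -> : jump i h P - jump i h Q
  = (h (setcoord i 1 P) - h (setcoord i 1 Q))
    - (h (setcoord i 0 P) - h (setcoord i 0 Q)) by rewrite /jump; ring.
apply: le_trans (ler_normB _ _) _.
by have := setL 0; have := setL 1; lra.
Qed.

Lemma gridmean_double L h M : (0 < M)%N -> lipschitz L h ->
  `|gridmean (2 * M) h - gridmean M h| <= L / (2 * M)%:R.
Proof.
move=> M0 [L0 Lh].
have bnd (b : 'I_M) (c : bool) : (2 * b + c < 2 * M)%N.
  by have := ltn_ord b; case: c; lia.
(* A fine index is [2 b + c] with [b] a coarse index and [c] a bit, so each fine grid point is a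
   coarse one moved by at most [1 / (2 * M)] in every coordinate. *)
pose f (bc : {ffun 'I_n -> 'I_M} * {ffun 'I_n -> bool}) : {ffun 'I_n -> 'I_(2 * M)} :=
  [ffun i => Ordinal (bnd (bc.1 i) (bc.2 i))].
have half (a : 'I_(2 * M)) : (a./2 < M)%N by have := ltn_ord a; lia.
pose g (a : {ffun 'I_n -> 'I_(2 * M)}) :=
  ([ffun i => Ordinal (half (a i))], [ffun i => odd (a i)]).
have fK : cancel f g.
  move=> [b c]; rewrite /f /g /=; congr pair; apply/ffunP => i.
    by apply/val_inj; rewrite !ffunE /=; case: (c i); lia.
  by rewrite !ffunE /=; case: (c i); lia.
have gK : cancel g f.
  move=> a; apply/ffunP => i; apply/val_inj; rewrite !ffunE /=.
  by rewrite mul2n addnC odd_double_half.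
have M2 : (2 * M)%:R != 0 :> R by rewrite pnatr_eq0; lia.
have MR : M%:R != 0 :> R by rewrite pnatr_eq0; lia.
have -> : gridmean (2 * M) h
    = gridmean M (fun P => (\sum_(c : {ffun 'I_n -> bool})
        h (P + \row_i ((c i)%:R / (2 * M)%:R))) / (2 ^ n)%:R).
  rewrite /gridmean (reindex f) /=; last by exists g => x _; rewrite ?fK ?gK.
  rewrite -mulr_suml -mulrA -invfM -natrM -expnMn; congr (_ / _).
  rewrite pair_bigA /=; apply: eq_bigr => -[b c] _ /=; congr h.
  apply/rowP => i; rewrite !mxE ffunE /= (natrD _ (2 * b i)) !(natrM _ 2); field.
  by rewrite MR.
rewrite gridmeanB; apply: norm_gridmean => // a.
have two0 : (2 ^ n)%:R != 0 :> R by rewrite pnatr_eq0 expn_eq0.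
have -> : h (gridpt a)
    = (\sum_(c : {ffun 'I_n -> bool}) h (gridpt a)) / (2 ^ n)%:R.
  by rewrite sumr_const card_ffun card_bool card_ord -[h _ *+ _]mulr_natr mulfK.
rewrite -mulrBl -sumrB normrM normfV [`|(2 ^ n)%:R|]ger0_norm//.
rewrite ler_pdivrMr; last by rewrite lt_def two0 /=.
apply: le_trans (ler_norm_sum _ _ _) _.
rewrite mulr_natr -[X in _ *+ (X ^ _)]card_bool -[X in _ *+ (_ ^ X)]card_ord.
rewrite -card_ffun -sumr_const.
apply: ler_sum => c _; apply: le_trans (Lh _ _) _.
rewrite addrAC subrr add0r.
apply: ler_wpM2l => //; apply: mxnorm_le; rewrite ?invr_ge0// => i.
rewrite mxE ger0_norm ?divr_ge0// ler_pdivrMr ?lt_def ?M2//= mulVf//.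
by rewrite lern1 leq_b1.
Qed.

End CubeMean.

(** The telescoping series of increments is dominated by a geometric series. *)
Lemma is_cvg_geometric_increments (R : realType) (u : R^nat) (K : R) :
  (forall m, `|u m.+1 - u m| <= K / (2 ^ m)%:R) -> cvgn u.
Proof.
move=> uK.
have cvg_norm : cvgn [normed series (telescope u)].
  apply: (@series_le_cvg _ _ (geometric K 2^-1)) => [m|m|m|] /=.
  - exact: normr_ge0.
  - by apply: le_trans (normr_ge0 _) (le_trans (uK m) _); rewrite natrX exprVn.
  - by rewrite /telescope; apply: le_trans (uK m) _; rewrite natrX exprVn.
  - by apply: is_cvg_geometric_series; rewrite ger0_norm ?invr_ge0// invf_lt1 ?ltr1n.
have := normed_cvg cvg_norm; rewrite telescopeK => cu.
rewrite (_ : u = (u \- cst (u 0%N)) \+ cst (u 0%N)).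
  by apply: is_cvgD => //; exact: is_cvg_cst.
by apply/funext => m /=; rewrite subrK.
Qed.

(** * Convergence, stability and directional bounds of the mean gradient *)

Section CubeMeanLimit.
Variables (R : realType) (n : nat).
Implicit Types (h g : 'rV[R]_n -> R) (P Q : 'rV[R]_n) (M m : nat) (i : 'I_n).

Lemma cubegrad_cvg L h i : lipschitz L h ->
  gridmean (2 ^ m) (jump i h) @[m --> \oo] --> cubegrad h 0 i.
Proof.
move=> /(lipschitz_jump i) Lh; rewrite mxE.
apply: (@is_cvg_geometric_increments _ _ (2 * L)) => m.
rewrite expnS; apply: le_trans (gridmean_double _ Lh) _; first by rewrite expn_gt0.
rewrite ler_wpM2l//; first by case: Lh.
rewrite lef_pV2 ?posrE ?ltr0n ?muln_gt0 ?expn_gt0// ler_nat; lia.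
Qed.

(** Only values on opposite faces of the unit cube enter, one on each face; hence the factor 2. *)
Lemma cubegrad_dist L L' h g e i : lipschitz L h -> lipschitz L' g ->
  (forall P, (forall j, 0 <= P 0 j <= 1) -> `|h P - g P| <= e) ->
  `|cubegrad h 0 i - cubegrad g 0 i| <= 2 * e.
Proof.
move=> Lh Lg hge.
have cvg_d : `|gridmean (2 ^ m) (jump i h) - gridmean (2 ^ m) (jump i g)| @[m --> \oo]
    --> `|cubegrad h 0 i - cubegrad g 0 i|.
  by apply: cvg_norm; apply: cvgB; [exact: cubegrad_cvg Lh|exact: cubegrad_cvg Lg].
rewrite -(cvg_lim _ cvg_d)//; apply: limr_le; first by apply/cvg_ex; eexists; exact: cvg_d.
apply: nearW => m; rewrite gridmeanB.
apply: norm_gridmean; rewrite ?expn_gt0// => a.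
have set01 (s : R) : 0 <= s <= 1 -> forall j, 0 <= setcoord i s (gridpt R a) 0 j <= 1.
  by move=> s01 j; rewrite mxE; case: ifP => // _; rewrite gridpt_ge0 gridpt_le1.
have := hge _ (set01 1 ltac:(by rewrite ler01 lexx)).
have := hge _ (set01 0 ltac:(by rewrite ler01 lexx)).
rewrite /jump !ler_norml => /andP[? ?] /andP[? ?].
by apply/andP; split; lra.
Qed.

Lemma cubegrad_linear u h : (forall P, (forall j, 0 <= P 0 j <= 1) -> h P = dotv P u) ->
  cubegrad h = u.
Proof.
move=> hu; apply/rowP => i; rewrite mxE.
rewrite (_ : (fun m => _) = cst (u 0 i)); first exact: lim_cst.
apply/funext => m /=; rewrite -[RHS](@gridmean_cst R n (2 ^ m)) ?expn_gt0//.
congr (_ / _); apply: eq_bigr => a _.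
have set01 (s : R) : 0 <= s <= 1 -> forall j, 0 <= setcoord i s (gridpt R a) 0 j <= 1.
  by move=> s01 j; rewrite mxE; case: ifP => // _; rewrite gridpt_ge0 gridpt_le1.
rewrite /jump !hu; [|by apply: set01; rewrite lexx ler01..].
rewrite -dotvBl /dotv (bigD1 i)//= !mxE eqxx subr0 mul1r big1 ?addr0// => j ji.
by rewrite !mxE (negbTE ji) subrr mul0r.
Qed.

(** An exact discrete divergence theorem: along each grid line parallel to axis [i] the differences
    telescope to the jump between the two faces. *)
Lemma gridmean_shift M h i : (0 < M)%N ->
  gridmean M (fun P => h (P + M%:R^-1 *: delta_mx 0 i)) - gridmean M h
    = M%:R^-1 * gridmean M (jump i h).
Proof.
move=> M0; have MR : M%:R != 0 :> R by rewrite pnatr_eq0 -lt0n.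
pose upd (a : {ffun 'I_n -> 'I_M}) (j : 'I_M) : {ffun 'I_n -> 'I_M} :=
  [ffun k => if k == i then j else a k].
(* Redrawing coordinate [i] uniformly does not change the mean: [(a, j)] to [(upd a j, a i)] is an
   involution. *)
have resample (F : {ffun 'I_n -> 'I_M} -> R) :
    \sum_a F a = M%:R^-1 * \sum_a \sum_j F (upd a j).
  rewrite (pair_bigA _ (fun a j => F (upd a j))) /=.
  rewrite (reindex_inj (h := fun aj => (upd aj.1 aj.2, aj.1 i))) /=; last first.
    apply: (can_inj (g := fun aj => (upd aj.1 aj.2, aj.1 i))) => -[a j] /=.
    congr pair; last by rewrite ffunE eqxx.
    by apply/ffunP => k; rewrite !ffunE; case: eqP => // ->.
  rewrite -(pair_bigA _ (fun a j => F (upd (upd a j) (a i)))) /=.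
  rewrite mulr_sumr; apply: eq_bigr => a _.
  have updK j : upd (upd a j) (a i) = a.
    by apply/ffunP => k; rewrite !ffunE; case: eqP => // ->.
  by under eq_bigr do rewrite updK; rewrite sumr_const card_ord -[F a *+ _]mulr_natl mulKf.
rewrite gridmeanB /gridmean resample mulrA; congr (_ * _ / _).
apply: eq_bigr => a _.
pose psi (j : nat) := h (setcoord i (j%:R / M%:R) (gridpt R a)).
rewrite (eq_bigr (fun j : 'I_M => psi j.+1 - psi j)) => [|j _].
  rewrite -(big_mkord xpredT (fun j => psi j.+1 - psi j)) telescope_sumr//.
  by rewrite /jump /psi divff// mul0r.
rewrite /psi; congr (h _ - h _); apply/rowP => k; rewrite !mxE ffunE.
  by rewrite eqxx /=; case: eqP => _; rewrite ?mulr1 ?mulr0 ?addr0// -natr1 mulrDl mul1r.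
by case: eqP.
Qed.

Lemma int_row_ind (Pr : 'rV[int]_n -> Prop) : Pr 0 ->
  (forall z i, Pr z -> Pr (z + delta_mx 0 i)) ->
  (forall z i, Pr z -> Pr (z - delta_mx 0 i)) -> forall z, Pr z.
Proof.
move=> P0 Padd Psub z.
have step y i c : Pr y -> Pr (y + c *: delta_mx 0 i).
  case: (intP c) => [|k|k] Py; first by rewrite scale0r addr0.
    elim: k => [|k IH]; first by rewrite scale1r; exact: Padd.
    by rewrite (intS k.+1) scalerDl scale1r addrCA addrC; exact: Padd.
  elim: k => [|k IH]; first by rewrite scaleN1r; exact: Psub.
  by rewrite (intS k.+1) opprD scalerDl scaleN1r addrCA addrC; exact: Psub.
rewrite (row_sum_delta z).
elim/big_rec : _ => // i y _ Py; rewrite addrC; exact: step.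
Qed.

(** A discrete directional derivative in an integer direction, with a second-order error. The shift
    is made of unit steps along the axes, each exact by [gridmean_shift] for an already shifted [h],
    whose jumps are within [O(1 / M)] of those of [h]. *)
Lemma gridmean_shift_int L h (z : 'rV[int]_n) : lipschitz L h ->
  exists C, forall M, (0 < M)%N ->
    `|gridmean M (fun P => h (P + M%:R^-1 *: map_mx intr z)) - gridmean M h
       - M%:R^-1 * dotv (map_mx intr z) (\row_i gridmean M (jump i h))|
    <= C / M%:R ^+ 2.
Proof.
move=> [L0 Lh].
(* Error of one unit step, with [mu = 1 / M] and [c] equal to 1 or -1 according to its direction. *)
have arith (mu S S' S0 D J J' C B c : R) : 0 <= mu -> `|c| = 1 ->
    S' - S = c * (mu * J) -> `|J - J'| <= B * mu ->
    `|S - S0 - mu * D| <= C * mu ^+ 2 ->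
    `|S' - S0 - mu * (D + c * J')| <= (C + B) * mu ^+ 2.
  move=> mu0 c1 SS' JJ' SD.
  have -> : S' - S0 - mu * (D + c * J') = (S - S0 - mu * D) + c * (mu * (J - J')).
    by rewrite -[S'](subrK S) SS'; ring.
  apply: le_trans (ler_normD _ _) _; rewrite mulrDl; apply: lerD => //.
  rewrite 2!normrM c1 mul1r ger0_norm// expr2 mulrA mulrC.
  by apply: ler_wpM2r.
have dot_delta M (i : 'I_n) :
    dotv (delta_mx 0 i) (\row_j gridmean M (jump j h)) = gridmean M (jump i h).
  rewrite /dotv (bigD1 i)//= !mxE !eqxx mul1r big1 ?addr0// => j ji.
  by rewrite !mxE eqxx (negbTE ji) mul0r.
have mapE i : map_mx intr (delta_mx 0 i : 'rV[int]_n) = delta_mx 0 i :> 'rV[R]_n.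
  by apply/rowP => j; rewrite !mxE eqxx /=; case: eqP.
have jumpL M V i : (0 < M)%N ->
    `|gridmean M (jump i (fun P => h (P + M%:R^-1 *: V))) - gridmean M (jump i h)|
      <= 2 * L * `|V| * M%:R^-1.
  move=> M0; rewrite gridmeanB; apply: norm_gridmean => // a; rewrite /jump.
  have shiftL P : `|h (P + M%:R^-1 *: V) - h P| <= L * `|V| * M%:R^-1.
    apply: le_trans (Lh _ _) _.
    by rewrite addrAC subrr add0r normrZ ger0_norm ?invr_ge0// mulrA mulrAC.
  have := shiftL (setcoord i 1 (gridpt R a)); have := shiftL (setcoord i 0 (gridpt R a)).
  rewrite !ler_norml => /andP[? ?] /andP[? ?]; apply/andP; split; lra.
elim/int_row_ind : z => [|z i [C CP]|z i [C CP]].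
- exists 0 => M M0; rewrite map_mx0 dotv0l mulr0 subr0 scaler0.
  by under eq_fun do rewrite addr0; rewrite subrr normr0 mul0r.
- pose V : 'rV[R]_n := map_mx intr z.
  exists (C + 2 * L * `|V|) => M M0; rewrite map_mxD mapE -/V dotvDl dot_delta.
  rewrite -exprVn -[gridmean M (jump i h)]mul1r.
  apply: (arith _ _ _ _ _ _ _ _ _ _ _ _ _ (jumpL M V i M0)).
  + by rewrite invr_ge0.
  + exact: normr1.
  + have := gridmean_shift (fun P => h (P + M%:R^-1 *: V)) i M0; rewrite mul1r => <-.
    congr (gridmean _ _ - _); apply/funext => P.
    by rewrite scalerDr addrA addrAC.
  + by rewrite exprVn; exact: CP.
(* A backward step is the exact forward step from its end point [V], read with sign -1. *)
- pose V : 'rV[R]_n := map_mx intr (z - delta_mx 0 i).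
  exists (C + 2 * L * `|V|) => M M0.
  have VE : V = map_mx intr z - delta_mx 0 i by rewrite /V map_mxB mapE.
  rewrite -/V {2}VE dotvBl dot_delta -exprVn -(mulN1r (gridmean M (jump i h))).
  apply: (arith _ _ _ _ _ _ _ _ _ _ _ _ _ (jumpL M V i M0)).
  + by rewrite invr_ge0.
  + by rewrite normrN1.
  + have := gridmean_shift (fun P => h (P + M%:R^-1 *: V)) i M0; rewrite mulN1r => <-.
    by rewrite opprB.
  + rewrite exprVn; have := CP M M0.
    by under eq_fun do rewrite -[map_mx intr z](subrKC (delta_mx 0 i)) -VE scalerDr addrA.
Qed.

(** Averaging the increment bound over the grid with [t = 1 / M] and dividing by [1 / M] leaves an
    error [C / M], which vanishes along [M = 2 ^ m]. The direction is integral so that the shifts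
    are multiples of the mesh. *)
Lemma cubegrad_le L h (z : 'rV[int]_n) s t0 : lipschitz L h -> 0 < t0 ->
  (forall P t, (forall j, 0 <= P 0 j <= 1) -> 0 < t -> t <= t0 ->
     h (P + t *: map_mx intr z) <= h P + t * s) ->
  dotv (map_mx intr z) (cubegrad h) <= s.
Proof.
move=> Lh t0_gt0 hs; have [C CP] := gridmean_shift_int z Lh.
pose V : 'rV[R]_n := map_mx intr z.
have cvg_dot : dotv V (\row_i gridmean (2 ^ m) (jump i h)) @[m --> \oo]
    --> dotv V (cubegrad h).
  apply: cvg_big => [|i _]; [exact: add_continuous|apply: cvgM]; first exact: cvg_cst.
  by under eq_fun do rewrite mxE; exact: cubegrad_cvg Lh.
have cvg_inv : ((2 ^ m)%:R^-1 : R) @[m --> \oo] --> (0 : R).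
  under eq_fun do rewrite natrX -exprVn.
  by apply: cvg_expr; rewrite ger0_norm ?invr_ge0// invf_lt1 ?ltr1n.
have cvg_rhs : s + C * (2 ^ m)%:R^-1 @[m --> \oo] --> s.
  rewrite -[X in _ --> X]addr0 -[X in _ --> _ + X](mulr0 C).
  by apply: cvgD; [exact: cvg_cst|apply: cvgM => //; exact: cvg_cst].
apply: (ler_cvg_to cvg_dot cvg_rhs).
near=> m.
have M0 : (0 < 2 ^ m)%N by rewrite expn_gt0.
have mu0 : 0 < (2 ^ m)%:R^-1 :> R by rewrite invr_gt0 ltr0n.
have mut : (2 ^ m)%:R^-1 <= t0.
  near: m; move/cvgrPdist_le : cvg_inv => /(_ _ t0_gt0).
  by apply: filterS => m; rewrite sub0r normrN ger0_norm ?invr_ge0.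
have := CP _ M0; rewrite ler_norml -/V => /andP[+ _].
have : gridmean (2 ^ m) (fun P => h (P + (2 ^ m)%:R^-1 *: V)) - gridmean (2 ^ m) h
    <= (2 ^ m)%:R^-1 * s.
  rewrite gridmeanB -[leRHS](@gridmean_cst R n (2 ^ m))//.
  apply: ler_gridmean => a; rewrite lerBlDl; apply: hs => //.
  by move=> j; rewrite gridpt_ge0 gridpt_le1.
move=> le1 ge1; rewrite -(ler_pM2l mu0); move: le1 ge1; rewrite -exprVn.
by move: (_^-1) (dotv _ _) => mu D; lra.
Unshelve. all: by end_near. Qed.

End CubeMeanLimit.

(** * The penalised support function of the epigraph of the conjugate *)

Section EpigraphSelection.
Variables (R : realType) (N : nat).
Implicit Types (H : 'rV[R]_N -> R) (u w P q : 'rV[R]_N.+1) (v y p : 'rV[R]_N).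

Definition rpart w : R := w 0 ord0.
Definition vpart w : 'rV[R]_N := \row_i w 0 (lift ord0 i).
Definition joinrv (r : R) v : 'rV[R]_N.+1 :=
  \row_j (if unlift ord0 j is Some i then v 0 i else r).

Lemma rpart_join r v : rpart (joinrv r v) = r.
Proof. by rewrite /rpart mxE unlift_none. Qed.

Lemma vpart_join r v : vpart (joinrv r v) = v.
Proof. by apply/rowP => i; rewrite !mxE liftK. Qed.

Lemma rpartB u w : rpart (u - w) = rpart u - rpart w.
Proof. by rewrite /rpart !mxE. Qed.

Lemma vpartB u w : vpart (u - w) = vpart u - vpart w.
Proof. by apply/rowP => i; rewrite !mxE. Qed.

Lemma dotv_parts u w : dotv u w = rpart u * rpart w + dotv (vpart u) (vpart w).
Proof.
by rewrite /dotv big_ord_recl; congr (_ + _); apply: eq_bigr => i _; rewrite !mxE.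
Qed.

Lemma norm1_parts w : norm1 w = `|rpart w| + norm1 (vpart w).
Proof.
by rewrite /norm1 big_ord_recl; congr (_ + _); apply: eq_bigr => i _; rewrite !mxE.
Qed.

(** Convex and Lipschitz with constant [a]; in the application [a] is [lam t x]. *)
Definition tame (a : R) H :=
  [/\ convexf H, 0 <= a & forall p p', `|H p - H p'| <= a * enorm (p - p')].

(* The epigraph of the convex conjugate of [H], with the vertical coordinate first. *)
Definition cepi H : set 'rV[R]_N.+1 :=
  [set w | forall y, dotv (vpart w) y - rpart w <= H y].

Definition gap H w y : R :=
  Num.max 0 ((dotv (vpart w) y - rpart w - H y) / (1 + enorm y)).

(* Vanishes exactly on [cepi H]; by [sandwich] it controls the distance to [cepi H]. *)
Definition defect H w : R := sup (range (gap H w)).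

Let den_gt0 y : 0 < 1 + enorm y.
Proof. by have := enorm_ge0 y; lra. Qed.

(** A Lipschitz [H] has at most linear growth, which the denominator [1 + enorm y] absorbs. *)
Lemma gap_bounded a H w : tame a H -> bounded_above (gap H w).
Proof.
move=> [_ a0 Ha]; exists (enorm (vpart w) + `|rpart w| + `|H 0| + a) => y.
have e0 := enorm_ge0 y; have v0 := enorm_ge0 (vpart w).
rewrite ge_max; apply/andP; split; first by rewrite !addr_ge0.
rewrite ler_pdivrMr//.
have := cauchy_schwarz (vpart w) y.
have := Ha 0 y; rewrite sub0r enormN => /(le_trans (ler_norm _)).
have := ler_norm (- rpart w); rewrite normrN.
have := ler_norm (- H 0); rewrite normrN.
have := normr_ge0 (rpart w); have := normr_ge0 (H 0).
nra.
Qed.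

Lemma defect_ge0 a H w : tame a H -> 0 <= defect H w.
Proof.
move=> tH; apply: le_trans (sup_range_ge 0 (gap_bounded w tH)).
by rewrite le_max lexx.
Qed.

Lemma defectP a H w y : tame a H ->
  dotv (vpart w) y - rpart w - defect H w * (1 + enorm y) <= H y.
Proof.
move=> tH; have := sup_range_ge y (gap_bounded w tH).
by rewrite ge_max => /andP[_]; rewrite ler_pdivrMr// -/(defect H w); lra.
Qed.

Lemma defect_epi H w : cepi H w -> defect H w = 0.
Proof.
move=> wH; have gap0 y : gap H w y = 0.
  by apply/max_idPl; rewrite pmulr_lle0 ?invr_gt0// subr_le0.
apply/eqP; rewrite eq_le; apply/andP; split.
  by apply: (sup_range_le 0) => y; rewrite gap0.
by rewrite -[leLHS](gap0 0); apply: sup_range_ge; exists 0 => y; rewrite gap0.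
Qed.

Lemma defect_le a H H' w w' e : tame a H' -> 0 <= e ->
  (forall y, dotv (vpart w) y - rpart w - H y
     <= dotv (vpart w') y - rpart w' - H' y + e * (1 + enorm y)) ->
  defect H w <= defect H' w' + e.
Proof.
move=> tH' e0 le_e; apply: (le_sup_range 0 (gap_bounded w' tH')) => y; exists y.
rewrite ge_max; apply/andP; split; first by rewrite addr_ge0// le_max lexx.
apply: (@le_trans _ _ ((dotv (vpart w') y - rpart w' - H' y) / (1 + enorm y) + e)).
  by rewrite -lerBlDr ler_pdivlMr// mulrBl divfK ?gt_eqF//; have := le_e y; lra.
by rewrite lerD2r le_max lexx orbT.
Qed.

Lemma defect_distl a H w w' : tame a H -> `|defect H w - defect H w'| <= norm1 (w - w').
Proof.
have aux u1 u2 y : dotv (vpart u1) y - rpart u1 - H y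
     <= dotv (vpart u2) y - rpart u2 - H y + norm1 (u1 - u2) * (1 + enorm y).
  have := dotv_le_norm1 y (vpart (u1 - u2)).
  have := mxnorm_le_enorm y; have := norm1_ge0 (vpart (u1 - u2)).
  have := ler_norm (- rpart (u1 - u2)); rewrite normrN.
  have := ler_norm (dotv y (vpart (u1 - u2))).
  rewrite norm1_parts rpartB vpartB dotvBr !(dotvC y).
  have := normr_ge0 (rpart u1 - rpart u2); have := enorm_ge0 y; nra.
move=> tH; rewrite ler_norml; apply/andP; split.
  rewrite lerNl opprB lerBlDl norm1_distC.
  by apply: (defect_le tH (norm1_ge0 _)) => y; exact: aux.
by rewrite lerBlDl; apply: (defect_le tH (norm1_ge0 _)) => y; exact: aux.
Qed.

Lemma defect_distr a a' H H' w e : tame a H -> tame a' H' ->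
  (forall y, `|H y - H' y| <= e * (1 + enorm y)) -> `|defect H w - defect H' w| <= e.
Proof.
move=> tH tH' HH'.
have e0 : 0 <= e.
  by have := le_trans (normr_ge0 _) (HH' 0); rewrite enorm0 addr0 mulr1.
rewrite ler_norml; apply/andP; split.
  rewrite lerNl opprB lerBlDl; apply: (defect_le tH e0) => y.
  by have := HH' y; rewrite ler_norml => /andP[]; lra.
rewrite lerBlDl; apply: (defect_le tH' e0) => y.
by have := HH' y; rewrite ler_norml => /andP[]; lra.
Qed.

(** [sandwich] moves [w] into [cepi H] by the defect [d] in height and by at most [d] in Euclidean
    norm horizontally, hence by at most [(sqrt N + 1) * d] in l1 norm. The factor 4 pays for
    [|P| <= 2] and for the weight 2 of the distance to [u]. *)
Definition penalty : R := 4 * (Num.sqrt N%:R + 1).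

Lemma penalty_ge0 : 0 <= penalty.
Proof. by rewrite mulr_ge0// addr_ge0// sqrtr_ge0. Qed.

Lemma nearby_epi a H w : tame a H ->
  exists2 w', cepi H w' & 4 * norm1 (w - w') <= penalty * defect H w.
Proof.
move=> tH; have d0 := defect_ge0 w tH; have [cH _ _] := tH.
have [v' [vv' v'H]] := sandwich cH d0 (fun y => defectP w y tH).
exists (joinrv (rpart w + defect H w) v').
  by move=> y /=; rewrite vpart_join rpart_join.
rewrite norm1_distC norm1_parts rpartB vpartB rpart_join vpart_join.
rewrite addrAC subrr add0r ger0_norm//.
have := norm1_le_enorm (v' - vpart w).
have := ler_wpM2l (sqrtr_ge0 N%:R) vv'; rewrite /penalty; lra.
Qed.

Definition score H u P w : R :=
  dotv P w - 2 * norm1 (w - u) - penalty * defect H w.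

(* The support function of [cepi H] with the exact penalty [2 |w - u|_1]. *)
Definition psupport H u P : R := sup (range (score H u P)).

(** For [|P| <= 2] the term [2 * norm1 (w - u)] dominates [dotv P (w - u)]. *)
Lemma score_le a H u P w : tame a H -> `|P| <= 2 -> score H u P w <= dotv P u.
Proof.
move=> tH P2; have := mulr_ge0 penalty_ge0 (defect_ge0 w tH).
have := dotv_le_norm1 P (w - u); have := ler_norm (dotv P (w - u)).
have := ler_wpM2r (norm1_ge0 (w - u)) P2.
rewrite /score dotvBr; lra.
Qed.

Lemma score_bounded a H u P : tame a H -> `|P| <= 2 -> bounded_above (score H u P).
Proof. by move=> tH P2; exists (dotv P u) => w; exact: score_le tH P2. Qed.

Lemma psupport_le a H u P : tame a H -> `|P| <= 2 -> psupport H u P <= dotv P u.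
Proof. by move=> tH P2; apply: (sup_range_le 0) => w; exact: score_le tH P2. Qed.

Lemma psupport_ge a H u P : tame a H -> `|P| <= 2 ->
  dotv P u - penalty * defect H u <= psupport H u P.
Proof.
move=> tH P2; apply: le_trans (sup_range_ge u (score_bounded u tH P2)).
by rewrite /score subrr /norm1 big1 ?mulr0 ?subr0// => i _; rewrite mxE normr0.
Qed.

Lemma psupport_epi a H u P : tame a H -> `|P| <= 2 -> cepi H u ->
  psupport H u P = dotv P u.
Proof.
move=> tH P2 uH; apply/eqP; rewrite eq_le (psupport_le _ tH)//=.
by have := psupport_ge u tH P2; rewrite (defect_epi uH) mulr0 subr0.
Qed.

(** The supremum runs over all [w], so scores are compared at one and the same [w] although the
    epigraphs differ. *)
Lemma psupport_dist a a' H H' u u' P e : tame a H -> tame a' H' -> `|P| <= 2 ->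
  (forall y, `|H y - H' y| <= e * (1 + enorm y)) ->
  `|psupport H u P - psupport H' u' P| <= penalty * e + 2 * norm1 (u - u').
Proof.
have aux a1 a2 H1 H2 u1 u2 : tame a1 H1 -> tame a2 H2 -> `|P| <= 2 ->
    (forall y, `|H1 y - H2 y| <= e * (1 + enorm y)) ->
    psupport H1 u1 P <= psupport H2 u2 P + (penalty * e + 2 * norm1 (u1 - u2)).
  move=> t1 t2 P2 H12.
  apply: (le_sup_range 0 (score_bounded u2 t2 P2)) => w; exists w; rewrite /score.
  have := defect_distr w t1 t2 H12; rewrite ler_norml => /andP[+ _].
  rewrite -subr_ge0 => /(mulr_ge0 penalty_ge0).
  have := norm1D (w - u1) (u1 - u2); rewrite addrA subrK; lra.
move=> t1 t2 P2 H12; rewrite ler_norml; apply/andP; split.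
  rewrite lerNl opprB lerBlDl norm1_distC; apply: aux t2 t1 P2 _ => y.
  by rewrite distrC.
by rewrite lerBlDl; exact: aux t1 t2 P2 _.
Qed.

(** As a supremum of affine functions [psupport H u] is convex in [P], and on the ball of radius 2
    it lies between [dotv P u - K] and [dotv P u]; it is therefore Lipschitz on the ball of radius
    3/2. *)
Lemma psupport_lip a H u P Q : tame a H -> `|P| <= 3 / 2 -> `|Q| <= 3 / 2 ->
  psupport H u Q <= psupport H u P + (2 * (penalty * defect H u) + norm1 u) * `|Q - P|.
Proof.
move=> tH P32 Q32; set K := penalty * defect H u.
have K0 : 0 <= K by rewrite mulr_ge0 ?penalty_ge0 ?(defect_ge0 _ tH).
have P2 : `|P| <= 2 by apply: le_trans P32 _; lra.
have Q2 : `|Q| <= 2 by apply: le_trans Q32 _; lra.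
have hP := psupport_ge u tH P2; have hQ := psupport_le u tH Q2.
have dPQ : dotv Q u <= dotv P u + norm1 u * `|Q - P|.
  have := dotv_le_norm1 (Q - P) u; have := ler_norm (dotv (Q - P) u).
  by rewrite dotvBl; lra.
set d := `|Q - P| in dPQ *.
(* For [d >= 1/2] one has [K <= 2 * K * d], and the two-sided bound suffices. *)
have [d12|d12] := leP (1 / 2) d; first by move: hP; rewrite -/K; nra.
have [d00|dN0] := eqVneq d 0.
  have QP : Q = P by apply/eqP; rewrite -subr_eq0 -normr_eq0 -/d d00.
  by rewrite d00 mulr0 addr0 QP.
have d0 : 0 < d by rewrite lt_def dN0 normr_ge0.
(* The segment from [P] through [Q] is prolonged to length 1/2, so [S] stays in the ball of radius 2
   and [Q] is a convex combination of [P] and [S]. *)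
pose S := P + (2 * d)^-1 *: (Q - P).
have S2 : `|S| <= 2.
  apply: le_trans (ler_normD _ _) _; rewrite normrZ ger0_norm ?invr_ge0; last lra.
  by rewrite -/d invfM mulfVK//; lra.
have hS := psupport_le u tH S2.
have QE : Q = (1 - 2 * d) *: P + (2 * d) *: S.
  rewrite scalerDr scalerA divff ?mulf_neq0// scale1r addrA -scalerDl subrK scale1r.
  by rewrite subrKC.
have hQ' : psupport H u Q <= (1 - 2 * d) * psupport H u P + 2 * d * psupport H u S.
  apply: (sup_range_le 0) => w.
  have -> : score H u Q w = (1 - 2 * d) * score H u P w + 2 * d * score H u S w.
    by rewrite {1}QE /score dotvDl !dotvZl; ring.
  apply: lerD; apply: ler_wpM2l; try lra; apply: sup_range_ge.
    exact: score_bounded tH P2.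
  exact: score_bounded tH S2.
have SE : 2 * d * dotv S u = 2 * d * dotv P u + dotv (Q - P) u.
  rewrite /S dotvDl dotvZl mulrDr mulrA divff ?mul1r// mulf_neq0//.
have := dotvBl Q P u; move: hP; rewrite -/K; nra.
Qed.

(* Moving [P] in a direction [q] with [rpart q < 0] costs at most the value of the
   support function of [cepi H] at [q]. *)
Lemma psupport_step a H u P q p (b t : R) : tame a H ->
  `|P| <= 2 -> `|P + t *: q| <= 2 -> 0 <= t -> 0 <= b ->
  rpart q = - b -> vpart q = b *: p ->
  psupport H u (P + t *: q) <= psupport H u P + t * (b * H p).
Proof.
move=> tH P2 Pq2 t0 b0 rq vq.
apply: (le_sup_range 0 (score_bounded u tH P2)) => w.
(* Passing from [w] to [w'] costs at most [4 * norm1 (w - w')], which the penalty at [w] covers; on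
   the epigraph [dotv q w' <= b * H p]. *)
have [w' w'H ww'] := nearby_epi w tH; exists w'.
have -> : score H u P w' = dotv P w' - 2 * norm1 (w' - u).
  by rewrite /score (defect_epi w'H) mulr0 subr0.
have qw' : t * dotv q w' <= t * (b * H p).
  apply: ler_wpM2l => //; rewrite dotv_parts rq vq dotvZl.
  by have := ler_wpM2l b0 (w'H p); rewrite dotvC; lra.
have := dotv_le_norm1 (P + t *: q) (w - w').
have := ler_norm (dotv (P + t *: q) (w - w')).
have := ler_wpM2r (norm1_ge0 (w - w')) Pq2.
have := norm1D (w - w') (w' - u); rewrite addrA subrK.
have := norm1D (w' - w) (w - u); rewrite addrA subrK (norm1_distC w' w).
by rewrite /score dotvBr (dotvDl P _ w') dotvZl; lra.
Qed.

End EpigraphSelection.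

(** * The selection from the epigraph as a mean gradient *)

Section Selection.
Variables (R : realType) (N : nat).
Implicit Types (H : 'rV[R]_N -> R) (u w P : 'rV[R]_N.+1) (p : 'rV[R]_N).

(** Projection onto the sup-norm ball of radius 3/2. It makes the support function Lipschitz on the
    whole space and leaves it unchanged within distance 1/2 of the unit cube, which leaves room for
    directional increments. *)
Definition clamp P : 'rV[R]_N.+1 :=
  \row_i Num.max (- (3 / 2)) (Num.min (3 / 2) (P 0 i)).

Lemma norm_clamp P : `|clamp P| <= 3 / 2.
Proof.
apply: mxnorm_le => [|i]; first by lra.
rewrite mxE ler_norml le_max lexx /= ge_max ge_min lexx /=.
by apply/andP; split => //; lra.
Qed.

Lemma clamp_id P : `|P| <= 3 / 2 -> clamp P = P.
Proof.
move=> P32; apply/rowP => i; rewrite mxE.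
have := le_trans (normr_entry P i) P32; rewrite ler_norml => /andP[lo up].
by rewrite (min_idPr up) (max_idPr lo).
Qed.

Lemma clamp_dist P Q : `|clamp P - clamp Q| <= `|P - Q|.
Proof.
have dist_max (c x y : R) : `|Num.max c x - Num.max c y| <= `|x - y|.
  have := ler_norm (x - y); have := ler_norm (- (x - y)); rewrite normrN ler_norml.
  by case: (leP c x) => ?; case: (leP c y) => ? ? ?; apply/andP; split; lra.
have dist_min (c x y : R) : `|Num.min c x - Num.min c y| <= `|x - y|.
  have := ler_norm (x - y); have := ler_norm (- (x - y)); rewrite normrN ler_norml.
  by case: (leP c x) => ?; case: (leP c y) => ? ? ?; apply/andP; split; lra.
apply: mxnorm_le => // i; rewrite !mxE.
apply: le_trans (dist_max _ _ _) _; apply: le_trans (dist_min _ _ _) _.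
by have := normr_entry (P - Q) i; rewrite !mxE.
Qed.

Lemma cube_norm P : (forall j, 0 <= P 0 j <= 1) -> `|P| <= 1.
Proof.
by move=> P01; apply: mxnorm_le => // j; have /andP[? ?] := P01 j; rewrite ger0_norm.
Qed.

Definition csupport H u P : R := psupport H u (clamp P).

Lemma csupport_lipschitz a H u : tame a H ->
  lipschitz (2 * (penalty R N * defect H u) + norm1 u) (csupport H u).
Proof.
move=> tH.
have L0 : 0 <= 2 * (penalty R N * defect H u) + norm1 u.
  by rewrite addr_ge0 ?mulr_ge0 ?norm1_ge0 ?(defect_ge0 _ tH) ?addr_ge0 ?sqrtr_ge0.
split => // P Q; rewrite /csupport.
apply: le_trans (ler_wpM2l L0 (clamp_dist P Q)).
rewrite ler_norml; apply/andP; split.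
  rewrite lerNl opprB lerBlDl -normrN opprB.
  exact: psupport_lip tH (norm_clamp _) (norm_clamp _).
by rewrite lerBlDl; exact: psupport_lip tH (norm_clamp _) (norm_clamp _).
Qed.

Definition selection H u : 'rV[R]_N.+1 := cubegrad (csupport H u).

Lemma selection_id a H u : tame a H -> cepi H u -> selection H u = u.
Proof.
move=> tH uH; apply: cubegrad_linear => P P01.
have P1 := cube_norm P01.
rewrite /csupport clamp_id; last by lra.
by apply: psupport_epi tH _ uH; lra.
Qed.

Lemma selection_dist a a' H H' u u' e i : tame a H -> tame a' H' ->
  (forall y, `|H y - H' y| <= e * (1 + enorm y)) ->
  `|selection H u 0 i - selection H' u' 0 i|
    <= 2 * (penalty R N * e + 2 * norm1 (u - u')).
Proof.
move=> tH tH' HH'.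
apply: (cubegrad_dist i (csupport_lipschitz u tH) (csupport_lipschitz u' tH')) => P P01.
rewrite /csupport; apply: psupport_dist tH tH' _ HH'.
by apply: le_trans (norm_clamp _) _; lra.
Qed.

(** The half-space inequality of the epigraph at [p] is a bound on the mean gradient in the
    direction [(-1, p)]. It is obtained at rational [p] from integer directions and extended to all
    [p] by the Lipschitz bound on [H]. *)
Lemma selection_epi a H u : tame a H -> cepi H (selection H u).
Proof.
move=> tH p /=; have [_ a0 Ha] := tH; set v := vpart _; set r := rpart _.
have grid_le (b : nat) (z : 'rV[int]_N) : (0 < b)%N ->
    dotv v (b%:R^-1 *: map_mx intr z) - r <= H (b%:R^-1 *: map_mx intr z).
  move=> b0; set pz := _ *: _; have bR : 0 < b%:R :> R by rewrite ltr0n.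
  pose q : 'rV[int]_N.+1 :=
    \row_j (if unlift ord0 j is Some i then z 0 i else - b%:Z).
  have qr : rpart (map_mx intr q) = - b%:R :> R.
    by rewrite /rpart !mxE unlift_none rmorphN.
  have qv : vpart (map_mx intr q) = b%:R *: pz :> 'rV[R]_N.
    rewrite /pz scalerA divff ?gt_eqF// scale1r.
    by apply/rowP => i; rewrite !mxE liftK.
  (* For [t <= t0] the increment [t * q] has norm at most 1/2, so clamping has no effect at
     [P + t * q]. *)
  pose t0 : R := (1 / 2) / (`|map_mx intr q : 'rV[R]_N.+1| + 1).
  have nq := normr_ge0 (map_mx intr q : 'rV[R]_N.+1).
  have t0_gt0 : 0 < t0 by rewrite divr_gt0//; lra.
  have : dotv (map_mx intr q) (selection H u) <= b%:R * H pz.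
    apply: (cubegrad_le (csupport_lipschitz u tH) t0_gt0) => P t P01 t_gt0 tt0.
    have P1 := cube_norm P01.
    have Pq : `|P + t *: map_mx intr q| <= 3 / 2.
      apply: le_trans (ler_normD _ _) _; rewrite normrZ gtr0_norm//.
      move: tt0; rewrite /t0 ler_pdivlMr; last by lra.
      nra.
    rewrite /csupport !clamp_id//; last by lra.
    apply: psupport_step tH _ _ (ltW t_gt0) (ltW bR) qr qv; first by lra.
    by apply: le_trans Pq _; lra.
  rewrite dotv_parts qr qv dotvZl -/v -/r [dotv pz v]dotvC.
  by rewrite -(ler_pM2l bR (_ - _)); lra.
rewrite -subr_le0 leNgt; apply/negP; set X := (X in 0 < X) => X0.
(* Lipschitz constant, in the sup norm, of the excess [dotv v p - r - H p]. Rounding [p] to the mesh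
   [1 / b] with [b > K / X] changes the excess by less than its supposed positive value [X]. *)
pose K := norm1 v + a * Num.sqrt N%:R.
have K0 : 0 <= K by rewrite addr_ge0 ?norm1_ge0// mulr_ge0// sqrtr_ge0.
pose b := (Num.truncn (K / X)).+1.
have bR : 0 < b%:R :> R by rewrite ltr0n.
have Kb : K < X * b%:R by rewrite mulrC -ltr_pdivrMr//; exact: truncnS_gt.
pose z : 'rV[int]_N := \row_i Num.floor (b%:R * p 0 i).
have := grid_le b z isT; set pz := _ *: _.
have ppz : `|p - pz| <= b%:R^-1.
  apply: mxnorm_le; rewrite ?invr_ge0// => i; rewrite !mxE.
  have := floor_itv (b%:R * p 0 i); rewrite intrD1 => /andP[fl fu].
  have -> : p 0 i - b%:R^-1 * (Num.floor (b%:R * p 0 i))%:~R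
    = b%:R^-1 * (b%:R * p 0 i - (Num.floor (b%:R * p 0 i))%:~R).
    by rewrite mulrBr mulKf ?gt_eqF.
  rewrite normrM gtr0_norm ?invr_gt0// -[leRHS]mulr1; apply: ler_wpM2l.
    by rewrite invr_ge0.
  by rewrite ger0_norm; lra.
have dv : dotv v p <= dotv v pz + norm1 v * b%:R^-1.
  have := dotv_le_norm1 (p - pz) v; rewrite dotvC dotvBr.
  have := ler_norm (dotv v p - dotv v pz); have := ler_wpM2l (norm1_ge0 v) ppz; lra.
have dH : H pz <= H p + a * Num.sqrt N%:R * b%:R^-1.
  have := ler_norm (H pz - H p); have := Ha pz p; rewrite enorm_distC.
  have := ler_wpM2l a0 (enorm_le_mxnorm (p - pz)).
  have := ler_wpM2l (mulr_ge0 a0 (sqrtr_ge0 N%:R)) ppz; lra.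
move=> pz_le; have : X <= K * b%:R^-1 by rewrite /X /K; lra.
by rewrite ler_pdivlMr//; lra.
Qed.

End Selection.

(** * Measurability of the selection in a parameter *)

Section Measurability.
Variable R : realType.

Lemma lipschitz_continuous n L (F : 'rV[R]_n -> R) : lipschitz L F -> continuous F.
Proof.
move=> [L0 LF] w; apply/(@cvgrPdist_le _ _ _ (nbhs w) (nbhs_filter w)) => e e0.
have e1 : 0 < e / (L + 1) by rewrite divr_gt0//; lra.
apply/nbhs_ballP; exists (e / (L + 1)) => //= w'; rewrite -ball_normE /= => /ltW ww'.
apply: le_trans (LF _ _) _; move: ww'; rewrite ler_pdivlMr; last by lra.
by have := normr_ge0 (w - w'); nra.
Qed.

Lemma dense_rat_rows n (w : 'rV[R]_n) e : 0 < e ->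
  exists z : 'rV[rat]_n, `|w - map_mx ratr z| < e.
Proof.
move=> e0.
have /choice[z zP] (i : 'I_n) : exists q : rat, `|w 0 i - ratr q| < e / 2.
  have /rat_in_itvoo[q] : w 0 i - e / 2 < w 0 i + e / 2 by lra.
  by rewrite in_itv /= => /andP[? ?]; exists q; rewrite ltr_norml; apply/andP; split; lra.
exists (\row_i z i); apply: (@le_lt_trans _ _ (e / 2)); last by lra.
by apply: mxnorm_le => [|i]; [lra|rewrite !mxE ltW].
Qed.

(** By continuity in [w] the supremum over all rows equals that over the countable set of rational
    rows. *)
Lemma measurable_fun_sup_rows (d : measure_display) (T : measurableType d) (D : set T)
    n (F : T -> 'rV[R]_n -> R) :
  (forall w, measurable_fun D (F^~ w)) -> (forall t, D t -> continuous (F t)) ->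
  (forall t, D t -> bounded_above (F t)) ->
  measurable_fun D (fun t => sup (range (F t))).
Proof.
move=> mF cF bF.
(* Enumeration of the rational rows; codes of no row give [0], which is harmless since it is a row
   as well. *)
pose e k : 'rV[R]_n := if unpickle k is Some z then map_mx (@ratr R) (z : 'rV[rat]_n) else 0.
apply: (@eq_measurable_fun _ _ _ _ D (fun t => sups (fun k => F t (e k)) 0)).
  move=> t /set_mem Dt; have [b Fb] := bF t Dt.
  apply/eqP; rewrite eq_le; apply/andP; split.
    apply: ge_sup; first by exists (F t (e 0%N)), 0%N.
    by move=> _ [k _ <-]; apply: sup_range_ge; exists b.
  apply: (sup_range_le 0) => w; apply/ler_addgt0Pr => r r0.
  have /cvgrPdist_lt/(_ _ r0) := cF t Dt w.
  move=> /nbhs_ballP[del /= del0 near_w].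
  have [z wz] := dense_rat_rows w del0.
  have := near_w (map_mx ratr z); rewrite -ball_normE /= => /(_ wz).
  rewrite ltr_norml => /andP[_ ltr].
  have ez : e (pickle z) = map_mx ratr z by rewrite /e pickleK.
  have : F t (map_mx ratr z) <= sup (sdrop (fun k => F t (e k)) 0).
    rewrite -ez; apply: ub_le_sup; last by exists (pickle z).
    by exists b => _ [k _ <-].
  by rewrite /sups /=; lra.
apply: measurable_fun_sups => // t Dt; have [b Fb] := bF t Dt.
by exists b => _ [k _ <-].
Qed.

Lemma continuous_enorm n : continuous (@enorm R n).
Proof.
apply: (@lipschitz_continuous _ (Num.sqrt n%:R)); split => [|P Q]; first exact: sqrtr_ge0.
have aux (x y : 'rV[R]_n) : enorm x - enorm y <= Num.sqrt n%:R * `|x - y|.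
  rewrite lerBlDr; apply: le_trans (lerD (enorm_le_mxnorm _) (lexx _)).
  by apply: le_trans (enormD _ _); rewrite subrK.
by rewrite ler_norml lerNl opprB {1}distrC !aux.
Qed.

Lemma continuous_dotv n (v : 'rV[R]_n) : continuous (dotv v).
Proof.
apply: (@lipschitz_continuous _ (norm1 v)); split => [|P Q]; first exact: norm1_ge0.
by rewrite -dotvBr dotvC mulrC dotv_le_norm1.
Qed.

Lemma tame_continuous N a (H : 'rV[R]_N -> R) : tame a H -> continuous H.
Proof.
move=> [_ a0 Ha]; apply: (@lipschitz_continuous _ (a * Num.sqrt N%:R)).
split => [|P Q]; first by rewrite mulr_ge0 ?sqrtr_ge0.
by apply: le_trans (Ha _ _) _; rewrite -mulrA ler_wpM2l ?enorm_le_mxnorm.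
Qed.

Variables (d : measure_display) (T : measurableType d) (D : set T) (N : nat).
Variables (H : T -> 'rV[R]_N -> R) (u : T -> 'rV[R]_N.+1).
Hypothesis mH : forall y, measurable_fun D (H^~ y).
Hypothesis mu : forall i, measurable_fun D (fun t => u t 0 i).
Hypothesis tH : forall t, D t -> exists a, tame a (H t).

Lemma measurable_defect w : measurable_fun D (fun t => defect (H t) w).
Proof.
apply: measurable_fun_sup_rows => [y|t Dt y|t Dt].
- apply: measurable_maxr; first exact: measurable_cst.
  apply: measurable_funM; last exact: measurable_cst.
  by apply: measurable_funB => //; exact: measurable_cst.
- have [a tHt] := tH Dt.
  pose num y := dotv (vpart w) y - rpart w - H t y.
  have cnum : {for y, continuous num}.
    apply: continuousB; last exact: tame_continuous tHt _.
    by apply: continuousB; [exact: continuous_dotv|exact: cst_continuous].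
  have cden : {for y, continuous (fun y => (1 + enorm y)^-1)}.
    apply: continuousV; first by rewrite gt_eqF// ltr_pwDl// enorm_ge0.
    by apply: continuousD; [exact: cst_continuous|exact: continuous_enorm].
  have c0 : {for y, continuous (cst (0 : R^o))} by exact: cst_continuous.
  exact: continuous_max c0 (continuousM cnum cden).
- by have [a tHt] := tH Dt; exact: gap_bounded tHt.
Qed.

Lemma measurable_psupport P : `|P| <= 2 ->
  measurable_fun D (fun t => psupport (H t) (u t) P).
Proof.
move=> P2; apply: measurable_fun_sup_rows => [w|t Dt|t Dt].
- apply: measurable_funB.
    apply: measurable_funB; first exact: measurable_cst.
    apply: measurable_funM; first exact: measurable_cst.
    apply: measurable_sum => i.
    under eq_fun do rewrite !mxE.
    apply: measurableT_comp; first exact: normr_measurable.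
    by apply: measurable_funB => //; exact: measurable_cst.
  by apply: measurable_funM; [exact: measurable_cst|exact: measurable_defect].
- have [a tHt] := tH Dt.
  apply: (@lipschitz_continuous _ ((`|P| + 2 + penalty R N) * N.+1%:R)).
  have pen0 := penalty_ge0 R N.
  split; first by rewrite mulr_ge0// !addr_ge0.
  move=> w w'; rewrite -mulrA; set L1 := _ * `|_|.
  have nL : norm1 (w - w') <= L1 by exact: norm1_le_mxnorm.
  apply: (@le_trans _ _ ((`|P| + 2 + penalty R N) * norm1 (w - w'))); last first.
    by apply: ler_wpM2l => //; rewrite !addr_ge0.
  have aux (w1 w2 : 'rV[R]_N.+1) : score (H t) (u t) P w1 - score (H t) (u t) P w2
      <= (`|P| + 2 + penalty R N) * norm1 (w1 - w2).
    have := defect_distl w2 w1 tHt; rewrite norm1_distC => /(le_trans (ler_norm _)).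
    move=> /(ler_wpM2l pen0).
    have := dotv_le_norm1 P (w1 - w2); have := ler_norm (dotv P (w1 - w2)).
    have := norm1D (w2 - w1) (w1 - u t); rewrite addrA subrK norm1_distC.
    by rewrite /score dotvBr; lra.
  by rewrite ler_norml lerNl opprB {1}norm1_distC !aux.
- by have [a tHt] := tH Dt; exact: score_bounded tHt P2.
Qed.

(** A pointwise limit of finite sums of values of [psupport], each measurable in [t]. *)
Lemma measurable_selection i :
  measurable_fun D (fun t => selection (H t) (u t) 0 i).
Proof.
apply: (@measurable_fun_cvg _ _ _ _
  (fun m t => gridmean (2 ^ m) (jump i (csupport (H t) (u t))))) => [m|t Dt]; last first.
  have [a tHt] := tH Dt; exact: cubegrad_cvg (csupport_lipschitz (u t) tHt).
apply: measurable_funM; last exact: measurable_cst.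
apply: measurable_sum => b; apply: measurable_funB;
  apply: measurable_psupport; apply: le_trans (norm_clamp _) _; lra.
Qed.

End Measurability.

(** * Parametrization of the truncated epigraph by the unit ball *)

Section Parametrization.
Variables (R : realType) (N : nat).
Implicit Types (H : 'rV[R]_N -> R) (u : 'rV[R]_N.+1) (v y p : 'rV[R]_N) (a : R).

(** The two-sided bound (H7) stated without extended values: a real upper bound [r] witnesses that
    [v] is in the domain of the conjugate. *)
Definition conj_bounded a H := forall v r, (forall y, dotv v y - H y <= r) ->
  - a <= r /\ forall y, dotv v y - H y <= a.

(** The points of the epigraph with height at most [a] satisfy [|r| <= a] and [enorm v <= a], so the
    ball of radius [2 * a] contains them and the selection fixes them. Truncating the height at [a]
    stays in the epigraph, since the conjugate is at most [a] on its domain. *)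
Definition fsel H a u : 'rV[R]_N := vpart (selection H ((2 * a) *: u)).
Definition lsel H a u : R := Num.min (rpart (selection H ((2 * a) *: u))) a.

Lemma fsel_lsel_epi H a u y : tame a H -> conj_bounded a H ->
  dotv (fsel H a u) y - H y <= lsel H a u.
Proof.
move=> tH bH; have epi := selection_epi ((2 * a) *: u) tH.
rewrite le_min; apply/andP; split; first by have := epi y; rewrite -/(fsel H a u); lra.
have [|_ ->//] := bH (fsel H a u) (rpart (selection H ((2 * a) *: u))).
by move=> z; have := epi z; rewrite -/(fsel H a u); lra.
Qed.

Lemma conj_dom_norm H a v r : tame a H -> (forall y, dotv v y - H y <= r) -> enorm v <= a.
Proof.
move=> [_ a0 Ha] vr; apply: (linear_growth (b := r + H 0)) => // y.
by have := vr y; have := ler_norm (H y - H 0); have := Ha y 0; rewrite subr0; lra.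
Qed.

Lemma enorm_parts (w : 'rV[R]_N.+1) : enorm w <= `|rpart w| + enorm (vpart w).
Proof.
have v0 := enorm_ge0 (vpart w); have r0 := normr_ge0 (rpart w).
rewrite -(@ler_pXn2r _ 2)// ?nnegrE ?addr_ge0 ?enorm_ge0//.
have rE : rpart w ^+ 2 = `|rpart w| ^+ 2 by rewrite real_normK ?num_real.
by rewrite sqr_enorm dotv_parts -sqr_enorm -expr2 rE; have := mulr_ge0 r0 v0; lra.
Qed.

Lemma fsel_lsel_onto H a v r : tame a H -> conj_bounded a H ->
  (forall y, dotv v y - H y <= r) -> r <= a ->
  exists2 u, cball1 u & (fsel H a u = v) /\ (lsel H a u = r).
Proof.
move=> tH bH vr ra; have [ar _] := bH _ _ vr; have va := conj_dom_norm tH vr.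
pose w := joinrv r v.
have wH : cepi H w by move=> y; rewrite vpart_join rpart_join; have := vr y; lra.
have wa : enorm w <= 2 * a.
  apply: le_trans (enorm_parts _) _; rewrite rpart_join vpart_join.
  suff : `|r| <= a by lra.
  by rewrite ler_norml ar ra.
suff [u u1 uw] : exists2 u, cball1 u & (2 * a) *: u = w.
  exists u => //; rewrite /fsel /lsel uw (selection_id tH wH) vpart_join rpart_join.
  by split => //; apply/min_idPl.
(* For [a = 0] the scaling is not invertible, but then [w = 0] and [u = 0] serves. *)
have [a0|aN0] := eqVneq a 0.
  exists 0; first by rewrite /cball1 /= enorm0.
  rewrite scaler0; apply/rowP => j; rewrite mxE; apply/esym/eqP; rewrite -normr_le0.
  by apply: le_trans (enorm_entry _ _) _; apply: le_trans wa _; rewrite a0 mulr0.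
have a0 : 0 < a by rewrite lt_def aN0; have [] := tH.
exists ((2 * a)^-1 *: w); last by rewrite scalerA divff ?scale1r// mulf_neq0.
have a2 : 0 < 2 * a by lra.
rewrite /cball1 /= enormZ ger0_norm ?invr_ge0 ?(ltW a2)//.
by rewrite [_^-1 * _]mulrC ler_pdivrMr ?mul1r.
Qed.

Lemma fsel_lsel_bound H a u : tame a H -> conj_bounded a H ->
  enorm (fsel H a u) + `|lsel H a u| <= 2 * a.
Proof.
move=> tH bH; have epi y := fsel_lsel_epi u y tH bH.
have fa := conj_dom_norm tH epi; have [al _] := bH _ _ epi.
suff : `|lsel H a u| <= a by lra.
by rewrite ler_norml al /lsel ge_min lexx orbT.
Qed.

Lemma dist_min (x x' b b' e : R) : `|x - x'| <= e -> `|b - b'| <= e ->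
  `|Num.min x b - Num.min x' b'| <= e.
Proof.
rewrite !ler_norml => /andP[? ?] /andP[? ?].
by case: (leP x b) => ?; case: (leP x' b') => ?; apply/andP; split; lra.
Qed.

(** Converts the dimensional constants into multiples of [sqrt (N + 1)]. *)
Lemma sqrtS_le : Num.sqrt N%:R + 1 <= 3 / 2 * Num.sqrt N.+1%:R :> R.
Proof.
have s0 := sqrtr_ge0 (N%:R : R); have s1 := sqrtr_ge0 (N.+1%:R : R).
rewrite -(@ler_pXn2r _ 2)// ?nnegrE ?addr_ge0 ?mulr_ge0//.
have : Num.sqrt N%:R ^+ 2 = N%:R :> R by rewrite sqr_sqrtr.
have : Num.sqrt N.+1%:R ^+ 2 = N%:R + 1 :> R by rewrite sqr_sqrtr// natr1.
move: (Num.sqrt N%:R) (Num.sqrt N.+1%:R) => x y yE xE.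
by rewrite exprMn yE -xE; have := sqr_ge0 (x - 4 / 5); lra.
Qed.

Lemma fsel_lsel_lipschitz H H' a a' u e : tame a H -> tame a' H' -> cball1 u ->
  `|a - a'| <= e -> (forall y, `|H y - H' y| <= e * (1 + enorm y)) ->
  enorm (fsel H a u - fsel H' a' u) + `|lsel H a u - lsel H' a' u|
    <= 40 * N.+1%:R * e.
Proof.
move=> tH tH' u1 aa' HH'.
have e0 : 0 <= e by apply: le_trans (normr_ge0 _) aa'.
pose sn : R := Num.sqrt N.+1%:R; pose sN : R := Num.sqrt N%:R.
have snE : sn ^+ 2 = N.+1%:R by rewrite sqr_sqrtr.
have sn0 : 0 <= sn := sqrtr_ge0 _; have sN0 : 0 <= sN := sqrtr_ge0 _.
have sNn : sN + 1 <= 3 / 2 * sn := sqrtS_le.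
have du : norm1 ((2 * a) *: u - (2 * a') *: u) <= 2 * e * sn.
  rewrite -scalerBl -mulrBr norm1Z normrM ger0_norm//.
  have := norm1_le_enorm u; have := ler_wpM2l sn0 u1; rewrite -/sn.
  have := norm1_ge0 u; have := normr_ge0 (a - a'); nra.
(* Coordinatewise bound from [selection_dist]. By [sqrtS_le], [B <= 20 * sn * e] and
   [(sN + 1) * B <= 30 * sn ^+ 2 * e], within the announced [40 * N.+1%:R * e]. *)
set B := 8 * (sN + 1) * e + 8 * sn * e.
have sel i : `|selection H ((2 * a) *: u) 0 i - selection H' ((2 * a') *: u) 0 i| <= B.
  apply: le_trans (selection_dist _ _ _ tH tH' HH') _.
  by rewrite /B /penalty -/sN; lra.
have B0 : 0 <= B by apply: le_trans (sel ord0).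
have f_le : enorm (fsel H a u - fsel H' a' u) <= sN * B.
  by apply: enorm_le => // i; have := sel (lift ord0 i); rewrite !mxE.
have l_le : `|lsel H a u - lsel H' a' u| <= B.
  apply: dist_min; first exact: sel.
  by apply: le_trans aa' _; rewrite /B; have := mulr_ge0 sn0 e0; have := mulr_ge0 sN0 e0; lra.
have : (sN + 1) * B <= 3 / 2 * sn * B by apply: ler_wpM2r.
have : (sN + 1) * e <= 3 / 2 * sn * e by apply: ler_wpM2r.
move=> le1 le2; have : B <= 20 * sn * e by rewrite /B; lra.
move=> /(ler_wpM2l sn0) le3; have : 0 <= sn ^+ 2 * e by rewrite mulr_ge0// sqr_ge0.
by rewrite -snE; lra.
Qed.

(** Stated along a filter so as to serve both continuity in [(x, u)] at fixed [t] and joint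
    continuity in (A5). *)
Lemma fsel_lsel_cvg (I : Type) (F : set_system I) (FF : Filter F)
    (Hi : I -> 'rV[R]_N -> R) (ai : I -> R) (ui : I -> 'rV[R]_N.+1) H a u :
  (\forall i \near F, tame (ai i) (Hi i)) -> tame a H ->
  (forall e, 0 < e -> \forall i \near F, forall y, `|Hi i y - H y| <= e * (1 + enorm y)) ->
  ai @ F --> a -> ui @ F --> u ->
  fsel (Hi i) (ai i) (ui i) @[i --> F] --> fsel H a u /\
  lsel (Hi i) (ai i) (ui i) @[i --> F] --> lsel H a u.
Proof.
move=> tHi tH HiH aia uiu.
have wi_w : (2 * ai i) *: ui i @[i --> F] --> (2 * a) *: u.
  by apply: cvgZ => //; apply: cvgM => //; exact: cvg_cst.
have near_sel e : 0 < e -> \forall i \near F, forall j,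
    `|selection H ((2 * a) *: u) 0 j - selection (Hi i) ((2 * ai i) *: ui i) 0 j| <= e.
  move=> e0.
  have pen0 := penalty_ge0 R N.
  (* Each of the two terms of [selection_dist] is thus at most [e / 2]. *)
  have e1 : 0 < e / (4 * (penalty R N + 1)) by rewrite divr_gt0//; lra.
  have e2 : 0 < e / (8 * N.+1%:R) by rewrite divr_gt0// mulr_gt0.
  have near_w := (@cvgrPdist_le _ _ _ F FF _ _).1 wi_w _ e2.
  near=> i => j.
  have tHii : tame (ai i) (Hi i) by near: i.
  have close : forall y, `|H y - Hi i y| <= e / (4 * (penalty R N + 1)) * (1 + enorm y).
    by move=> y; rewrite distrC; move: y; near: i; exact: HiH.
  have wclose : `|(2 * a) *: u - (2 * ai i) *: ui i| <= e / (8 * N.+1%:R).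
    by near: i; exact: near_w.
  apply: le_trans (selection_dist _ _ _ tH tHii close) _.
  have := norm1_le_mxnorm ((2 * a) *: u - (2 * ai i) *: ui i).
  have n0 : 0 < N.+1%:R :> R by rewrite ltr0n.
  have := ler_wpM2l (ltW n0) wclose.
  have -> : N.+1%:R * (e / (8 * N.+1%:R)) = e / 8 by field; rewrite gt_eqF.
  have : penalty R N * (e / (4 * (penalty R N + 1))) <= e / 4.
    rewrite mulrA ler_pdivrMr; last by lra.
    by have := mulr_ge0 pen0 (ltW e0); lra.
  by lra.
split; apply/cvgrPdist_le => e e0; have := near_sel e e0.
  apply: filterS => i sel_i; apply: mxnorm_le; first exact: ltW.
  by move=> j; have := sel_i (lift ord0 j); rewrite !mxE.
have near_a := (@cvgrPdist_le _ _ _ F FF _ _).1 aia _ e0.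
move=> sel_e; near=> i; apply: dist_min.
  by near: i; apply: filterS sel_e => i /(_ ord0).
by near: i; exact: near_a.
Unshelve. all: by end_near. Qed.

(** A subgradient [v] at [z] has conjugate value [dotv v z - H z], between [- a] and [a]. The
    subgradient at [p] gives the lower bound, the one at [s *: p] the upper bound. *)
Lemma tame_homogeneous H a p s : tame a H -> conj_bounded a H -> 1 <= s ->
  `|H (s *: p) - s * H p| <= (s - 1) * a.
Proof.
move=> [cH _ _] bH s1.
have bnd z : exists v, [/\ forall y, H z + dotv v (y - z) <= H y,
    - a <= dotv v z - H z & dotv v z - H z <= a].
  have [v vP] := subgradient z cH; exists v.
  have [|lo up] := bH v (dotv v z - H z).
    by move=> y; have := vP y; rewrite dotvBr; lra.
  by split => //; exact: up.
rewrite ler_norml; apply/andP; split.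
  have [v [vP lo up]] := bnd p; have := vP (s *: p); rewrite dotvBr dotvZr; nra.
have [v [vP lo up]] := bnd (s *: p); have := vP p; rewrite dotvBr dotvZr.
by move: lo up; rewrite dotvZr; nra.
Qed.

(** A point outside the ball is [s *: p1] with [p1] on its boundary. Near homogeneity carries the
    estimate from [p1] to [p], and [K] is large enough to absorb the errors [(s - 1) * a] and
    [(s - 1) * a']. *)
Lemma uniform_of_local H H' a a' K e : tame a H -> tame a' H' ->
  conj_bounded a H -> conj_bounded a' H' -> 0 < K -> 0 <= e ->
  e + a + a' <= e * K -> (forall p, `|p| <= K -> `|H p - H' p| <= e) ->
  forall p, `|H p - H' p| <= e * (1 + enorm p).
Proof.
move=> tH tH' bH bH' K0 e0 eK HH' p; have p0 := enorm_ge0 p.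
have [pK|Kp] := leP `|p| K; first by apply: le_trans (HH' p pK) _; nra.
pose s := `|p| / K; pose p1 := s^-1 *: p.
have s1 : 1 <= s by rewrite ler_pdivlMr ?mul1r ?ltW.
have s0 : 0 < s by lra.
have pE : p = s *: p1 by rewrite scalerA divff ?scale1r ?gt_eqF.
have p1K : `|p1| <= K.
  by rewrite normrZ gtr0_norm ?invr_gt0// mulrC ler_pdivrMr// /s mulrC divfK// gt_eqF.
have := HH' p1 p1K; have := tame_homogeneous p1 tH bH s1.
have := tame_homogeneous p1 tH' bH' s1; rewrite -pE.
have sK : s * K <= enorm p by rewrite /s divfK ?gt_eqF// mxnorm_le_enorm.
have [_ a0 _] := tH; have [_ a0' _] := tH'.
rewrite !ler_norml => /andP[? ?] /andP[? ?] /andP[? ?].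
have sH1 : s * (H p1 - H' p1) <= s * e by apply: ler_wpM2l => //; lra.
have sH2 : s * (H' p1 - H p1) <= s * e by apply: ler_wpM2l => //; lra.
have seK : s * (e + a + a') <= s * (e * K) by apply: ler_wpM2l => //; lra.
have ep : e * (s * K) <= e * enorm p by apply: ler_wpM2l.
by apply/andP; split; lra.
Qed.

End Parametrization.

(** * Real-valued bounds on the extended-valued conjugate *)

Section Conjugate.
Variables (R : realType) (N : nat) (H : R -> 'rV[R]_N -> 'rV[R]_N -> R).
Implicit Types (t r : R) (x v p : 'rV[R]_N).

Lemma Hstar_leP t x v r :
  (Hstar H t x v <= r%:E)%E <-> forall p, dotv v p - H t x p <= r.
Proof.
split=> [Hr p|vr].
  rewrite -lee_fin; apply: le_trans Hr; apply: ereal_sup_ubound.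
  by exists p.
by apply: ge_ereal_sup => _ [p _ <-]; rewrite lee_fin.
Qed.

Lemma domHs_of_le t x v r : (forall p, dotv v p - H t x p <= r) -> domHs H t x v.
Proof. by move=> /Hstar_leP vr; apply: le_lt_trans vr (ltry _). Qed.

End Conjugate.

(** * From joint continuity of [H] to weighted uniform closeness in [p] *)

Section LocalUniformity.
Variables (R : realType) (N : nat).

Lemma compact_norm_le (K : R) : compact [set p : 'rV[R]_N | `|p| <= K].
Proof.
apply: bounded_closed_compact.
  by exists K; split; [exact: num_real|move=> M KM p /= /le_trans; apply; exact: ltW].
rewrite (_ : mkset _ = closed_ball_ (fun p : 'rV[R]_N => `|p|) 0 K).
  exact: closed_closed_ball_.
by apply/seteqP; split => p; rewrite /closed_ball_ /= sub0r normrN.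
Qed.

Lemma near_uniform (H : R -> 'rV[R]_N -> 'rV[R]_N -> R) (lam : R -> 'rV[R]_N -> R)
    (s0 : R * 'rV[R]_N) (e : R) :
  (forall t x, 0 <= t -> tame (lam t x) (H t x)) ->
  (forall t x, 0 <= t -> conj_bounded (lam t x) (H t x)) ->
  {within [set z : R * 'rV[R]_N * 'rV[R]_N | 0 <= z.1.1],
     continuous (fun z => H z.1.1 z.1.2 z.2)} ->
  lam s.1 s.2 @[s --> within [set s : R * 'rV[R]_N | 0 <= s.1] (nbhs s0)]
    --> lam s0.1 s0.2 ->
  0 <= s0.1 -> 0 < e ->
  \forall s \near within [set s : R * 'rV[R]_N | 0 <= s.1] (nbhs s0),
    forall y, `|H s.1 s.2 y - H s0.1 s0.2 y| <= e * (1 + enorm y).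
Proof.
move=> tH bH /subspace_continuousP cH clam t0 e0.
set F := within _ _ in clam *.
have FF : Filter F := within_filter _ (nbhs_filter s0).
(* The value 1 added to [lam] bounds [lam] at nearby points, so [K] meets the size condition of
   [uniform_of_local] there. *)
pose K := (e + (lam s0.1 s0.2 + 1) + lam s0.1 s0.2) / e.
have [_ l0 _] := tH s0.1 s0.2 t0.
have K0 : 0 < K by rewrite divr_gt0//; lra.
have eK : e * K = e + (lam s0.1 s0.2 + 1) + lam s0.1 s0.2.
  by rewrite /K mulrC divfK// gt_eqF.
have loc : \forall s \near F,
    [set p : 'rV[R]_N | `|p| <= K] `<=` [set p | `|H s.1 s.2 p - H s0.1 s0.2 p| <= e].
  (* Tube argument: compactness of the ball turns closeness near each [p] into closeness uniform in
     [p]. *)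
  have /compact_near_coveringP cov := @compact_norm_le K.
  apply: (cov _ F (fun s p => `|H s.1 s.2 p - H s0.1 s0.2 p| <= e)) => p _.
  have e2 : 0 < e / 2 by lra.
  have := (@cvgrPdist_le _ _ _ (within _ (nbhs (s0, p))) _ _ _).1 (cH (s0, p) t0) _ e2.
  move=> [[U V] /= [nU nV] UV].
  exists (V, [set s | 0 <= s.1 /\ U s]).
    by split => //=; apply: filterS nU => s Us.
  move=> [p' s] [/= Vp' [ts Us]].
  have := UV (s0, p') (conj (nbhs_singleton nU) Vp') t0.
  have := UV (s, p') (conj Us Vp') ts.
  rewrite /from_subspace /= !ler_norml => /andP[? ?] /andP[? ?].
  by apply/andP; split; lra.
have laml : \forall s \near F, lam s.1 s.2 <= lam s0.1 s0.2 + 1.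
  have := (@cvgrPdist_le _ _ _ F FF _ _).1 clam _ ltr01.
  by apply: filterS => s; rewrite /from_subspace /= ler_norml => /andP[+ _]; lra.
near=> s.
have ts : 0 <= s.1.
  by near: s; exact: (@withinT _ (nbhs s0) _ (nbhs_filter s0)).
apply: (uniform_of_local (tH _ _ ts) (tH _ _ t0) (bH _ _ ts) (bH _ _ t0) K0 (ltW e0)).
  have ls : lam s.1 s.2 <= lam s0.1 s0.2 + 1 by near: s.
  by rewrite eK; lra.
by move=> p pK; move: p pK; near: s; apply: filterS loc => s Hs p; exact: Hs.
Unshelve. all: by end_near. Qed.

End LocalUniformity.

(** * Assembly of the parametrization and its properties *)

Theorem theorem3p5 (R : realType) (N : nat) (A : set 'rV[R]_N)
  (H : R -> 'rV[R]_N -> 'rV[R]_N -> R) (phi : R -> R)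
  (lam : R -> 'rV[R]_N -> R) (c k q : R -> R) :
  A !=set0 -> closed A ->
  cond_hH A H phi lam c k q ->
  exists (f : R -> 'rV[R]_N -> 'rV[R]_N.+1 -> 'rV[R]_N)
         (l : R -> 'rV[R]_N -> 'rV[R]_N.+1 -> R),
    (* measurable in t for all (x,u) *)
    (forall x u (i : 'I_N), lmeasurable `[0, +oo[ (fun t => f t x u 0 i)) /\
    (forall x u, lmeasurable `[0, +oo[ (fun t => l t x u)) /\
    (* continuous in (x,u) for all t *)
    (forall t, 0 <= t ->
       continuous (fun xu : 'rV[R]_N * 'rV[R]_N.+1 => f t xu.1 xu.2)) /\
    (forall t, 0 <= t ->
       continuous (fun xu : 'rV[R]_N * 'rV[R]_N.+1 => l t xu.1 xu.2)) /\
    (* representation of H *)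
    (forall t x p, 0 <= t ->
       (H t x p)%:E =
       ereal_sup [set (dotv p (f t x u) - l t x u)%:E | u in @cball1 R N.+1]) /\
    (forall t x, 0 <= t -> f t x @` @cball1 R N.+1 = domHs H t x) /\
    (* (A1) *)
    (forall t x y u, 0 <= t -> @cball1 R N.+1 u ->
       enorm (f t x u - f t y u) + `|l t x u - l t y u|
         <= 40 * (N.+1)%:R * k t * enorm (x - y)) /\
    (* (A2) *)
    (forall t x u, 0 <= t -> @cball1 R N.+1 u ->
       enorm (f t x u) + `|l t x u| <= 20 * lam t x) /\
    (* (A3) *)
    (forall t x, 0 <= t ->
       gphHs H t x `<=` (fun u => (f t x u, l t x u)) @` @cball1 R N.+1 /\
       (fun u => (f t x u, l t x u)) @` @cball1 R N.+1 `<=` epiHs H t x) /\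
    (* (A4) *)
    (forall t x u, 0 <= t -> phi t <= l t x u) /\
    (* (A5) *)
    ({within [set z : R * 'rV[R]_N * 'rV[R]_N | 0 <= z.1.1],
        continuous (fun z => H z.1.1 z.1.2 z.2)} ->
     {within [set z : R * 'rV[R]_N | 0 <= z.1],
        continuous (fun z => lam z.1 z.2)} ->
     {within [set z : R * 'rV[R]_N * 'rV[R]_N.+1 | 0 <= z.1.1],
        continuous (fun z => f z.1.1 z.1.2 z.2)} /\
     {within [set z : R * 'rV[R]_N * 'rV[R]_N.+1 | 0 <= z.1.1],
        continuous (fun z => l z.1.1 z.1.2 z.2)}).
Proof.
move=> _ _ [mH [_ [cvxH [H0 [_ [lam0 [mlam [clam [_ [_ [_ [_ [_ [lipl [lipx [lipp cb]]]]]]]]]]]]]]]].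
have tH t x : 0 <= t -> tame (lam t x) (H t x).
  by move=> t0; split; [exact/convex_functionP/cvxH|exact: lam0|move=> p p'; exact: lipp].
have bH t x : 0 <= t -> conj_bounded (lam t x) (H t x).
  move=> t0 v r vr; have /andP[lo up] := cb t x v t0 (domHs_of_le vr).
  split; last exact/Hstar_leP.
  by move/Hstar_leP : vr => /(le_trans lo); rewrite lee_fin.
pose f t x u := fsel (H t x) (lam t x) u; pose l t x u := lsel (H t x) (lam t x) u.
have epi t x u y : 0 <= t -> dotv (f t x u) y - H t x y <= l t x u.
  by move=> t0; exact: fsel_lsel_epi (tH _ _ t0) (bH _ _ t0).
have onto t x v r : 0 <= t -> (forall y, dotv v y - H t x y <= r) -> r <= lam t x ->
    exists2 u, cball1 u & (f t x u = v) /\ (l t x u = r).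
  by move=> t0; exact: fsel_lsel_onto (tH _ _ t0) (bH _ _ t0).
have gph t x : 0 <= t ->
    gphHs H t x `<=` (fun u => (f t x u, l t x u)) @` @cball1 R N.+1.
  move=> t0 [v r] [/= dv Hr].
  have vr : forall y, dotv v y - H t x y <= r by apply/Hstar_leP; rewrite Hr.
  have /andP[_] := cb t x v t0 dv; rewrite Hr lee_fin => /(onto t x v r t0 vr).
  by move=> [u u1 [fu lu]]; exists u; rewrite ?fu ?lu.
have tS t : `[0, +oo[%classic t -> 0 <= t by rewrite /= in_itv /= andbT.
have msel x u i :
    lmeasurable `[0, +oo[ (fun t => selection (H t x) ((2 * lam t x) *: u) 0 i).
  apply: measurable_selection => [y|j|t /tS t0].
  - exact: mH.
  - rewrite (_ : (fun t => _) = (fun t => 2 * lam t x * u 0 j)); last first.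
      by apply/funext => t; rewrite mxE.
    apply: measurable_funM; last exact: measurable_cst.
    by apply: measurable_funM; [exact: measurable_cst|exact: mlam].
  - by exists (lam t x); exact: tH.
have cfl t (z0 : 'rV[R]_N * 'rV[R]_N.+1) : 0 <= t ->
    (f t z.1 z.2 @[z --> z0] --> f t z0.1 z0.2) /\
    (l t z.1 z.2 @[z --> z0] --> l t z0.1 z0.2).
  move=> t0.
  have cfst : z.1 @[z --> z0] --> z0.1 by exact: cvg_fst.
  apply: (@fsel_lsel_cvg _ _ _ (nbhs z0) (nbhs_filter z0)
    (fun z => H t z.1) (fun z => lam t z.1) snd).
  - by apply: nearW => z; exact: tH.
  - exact: tH.
  (* (H5) carries the weight [1 + enorm p], so it gives exactly the uniform closeness required; [L]
     converts the Euclidean norm into the sup norm. *)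
  - move=> e e0; pose L := `|k t| * Num.sqrt N%:R.
    have L0 : 0 <= L by rewrite mulr_ge0 ?sqrtr_ge0.
    have e1 : 0 < e / (L + 1) by rewrite divr_gt0//; lra.
    have := (@cvgrPdist_le _ _ _ (nbhs z0) (nbhs_filter z0) _ _).1 cfst _ e1.
    apply: filterS => z zz0 y; apply: le_trans (lipx t z.1 z0.1 y t0) _.
    rewrite mulrAC; apply: ler_wpM2r; first by rewrite addr_ge0 ?enorm_ge0.
    rewrite enorm_distC.
    have := ler_wpM2l (normr_ge0 (k t)) (enorm_le_mxnorm (z0.1 - z.1)).
    have := ler_wpM2r (enorm_ge0 (z0.1 - z.1)) (ler_norm (k t)).
    move: zz0; rewrite ler_pdivlMr; last by lra.
    by rewrite mulrA -/L; have := normr_ge0 (z0.1 - z.1); lra.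
  - exact: (cvg_comp _ _ cfst (clam t t0 z0.1)).
  - exact: cvg_snd.
exists f, l; split; [|split; [|split; [|split; [|split; [|split; [|split; [|split; [|split; [|split]]]]]]]]].
- move=> x u i; rewrite (_ : (fun t => _) =
    fun t => selection (H t x) ((2 * lam t x) *: u) 0 (lift ord0 i)); first exact: msel.
  by apply/funext => t; rewrite mxE.
- move=> x u; apply: measurable_minr; first exact: msel.
  exact: mlam.
- by move=> t t0 z; have [] := cfl t z t0.
- by move=> t t0 z; have [] := cfl t z t0.
- move=> t x p t0; apply/eqP; rewrite eq_le; apply/andP; split; last first.
    apply: ge_ereal_sup => _ [u _ <-]; rewrite lee_fin dotvC.
    by have := epi t x u p t0; lra.
  (* The supremum is attained at a subgradient [v] at [p], with height [dotv v p - H t x p], the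
     conjugate at [v] by Fenchel equality. *)
  have [cH _ _] := tH t x t0; have [v vP] := subgradient p cH.
  have vr y : dotv v y - H t x y <= dotv v p - H t x p.
    by have := vP y; rewrite dotvBr; lra.
  have [_ /(_ p) rl] := bH t x t0 _ _ vr.
  have [u u1 [fu lu]] := onto t x v _ t0 vr rl.
  apply: ereal_sup_ubound; exists u => //; rewrite fu lu (dotvC p v).
  by congr EFin; lra.
- move=> t x t0; apply/seteqP; split => [_ [u _ <-]|v dv].
    by apply: (@domHs_of_le _ _ _ _ _ _ (l t x u)) => p; exact: epi.
  have /andP[lo up] := cb t x v t0 dv.
  (* The point of height [lam t x] above [v] is in the epigraph and is reached by the
     parametrization. *)
  have [|u u1 [fu _]] := onto t x v (lam t x) t0 _ (lexx _); first exact/Hstar_leP.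
  by exists u.
- move=> t x y u t0 u1; rewrite -mulrA.
  apply: (fsel_lsel_lipschitz (tH _ _ t0) (tH _ _ t0) u1); first exact: lipl.
  by move=> p; rewrite mulrAC; exact: lipx.
- move=> t x u t0 u1; apply: le_trans (fsel_lsel_bound _ (tH _ _ t0) (bH _ _ t0)) _.
  by have := lam0 t x t0; lra.
- move=> t x t0; split; first exact: gph.
  by move=> _ [u _ <-]; apply/Hstar_leP => p; exact: epi.
(* The epigraph inequality at [0] reads [- H t x 0 <= l t x u], and (H2) concludes. *)
- move=> t x u t0; have := epi t x u 0 t0; rewrite dotv0r.
  by have := H0 t x t0; lra.
- move=> cH /subspace_continuousP cl.
  set A5 := [set z : R * 'rV[R]_N * 'rV[R]_N.+1 | 0 <= z.1.1].
  have cfl5 z0 : A5 z0 ->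
      (f z.1.1 z.1.2 z.2 @[z --> within A5 (nbhs z0)] --> f z0.1.1 z0.1.2 z0.2) /\
      (l z.1.1 z.1.2 z.2 @[z --> within A5 (nbhs z0)] --> l z0.1.1 z0.1.2 z0.2).
    move=> t0; have FF := within_filter A5 (nbhs_filter z0).
    have cfst : z.1 @[z --> z0] --> z0.1 by exact: cvg_fst.
    apply: (@fsel_lsel_cvg _ _ _ (within A5 (nbhs z0)) FF
      (fun z => H z.1.1 z.1.2) (fun z => lam z.1.1 z.1.2) snd).
    - by apply: filterS (@withinT _ (nbhs z0) A5 (nbhs_filter z0)) => z; exact: tH.
    - exact: tH.
    - move=> e e0; exact: (cfst _ (near_uniform tH bH cH (cl _ t0) t0 e0)).
    - by move=> W nW; exact: (cfst _ (cl _ t0 _ nW)).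
    - by apply: cvg_within_filter; exact: cvg_snd.
  by split; apply/subspace_continuousP => z z0; have [] := cfl5 z z0.
Qed.
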